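(* Let $a>0$ be a fixed real number. For any integer $k>1$ we have $$ \mathbb{E}\, Y_n(k) = \frac{(a+1)\Gamma(2a+1)}{\Gamma(a+1)\,k^{a}}\, n \left(1 + O\left(\frac{(\ln k)^{\lceil a+1\rceil }}{k}\right) +O\left(\frac{k^{1+a}}{n}\right) \right), $$ where $Y_n(k)$ is the number of vertices of second degree at least $k$ in the Buckley--Osthus random graph $H_{a,1}^n$. (The implied constants depend only on $a$, not on $n$ or $k$.)
   Context: Buckley--Osthus model ($m=1$). Fix $a>0$. The random multigraph $H_{a,1}^n$ on vertices $1,\dots,n$ is built inductively: $H_{a,1}^1$ consists of one vertex and one loop. Given $H_{a,1}^{t-1}$, the graph $H_{a,1}^{t}$ is obtained by adding one vertex $t$ and one edge between $t$ and a random vertex $i\in\{1,\dots,t\}$, where $$\Pr(i=s)=\frac{d_{H_{a,1}^{t-1}}(s)-1+a}{(a+1)t-1}\ \text{ if } 1\le s\le t-1,\qquad \Pr(i=t)=\frac{a}{(a+1)t-1}.$$ Here $d_H(s)$ is the degree of the vertex $s$ in $H$ (a loop contributes $2$ to the degree). Second degree: for a vertex $t$ of $H_{a,1}^n$, $$d_2(t)=\#\{ij:\ i\neq t,\ j\neq t,\ it\in H_{a,1}^n,\ ij\in H_{a,1}^n\},$$ i.e. the number of edges adjacent to the neighbors of $t$, except for the edges adjacent to $t$. $Y_n(k)$ is the number of vertices $t$ of $H_{a,1}^n$ with $d_2(t)\ge k$. *)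

(* Defs.v *)
From mathcomp Require Import all_boot all_order all_algebra.
From mathcomp Require Import all_classical all_reals all_analysis.
From mathcomp Require Import ring.

Set Implicit Arguments.
Unset Strict Implicit.
Unset Printing Implicit Defensive.

Import Order.TTheory GRing.Theory Num.Theory.

Local Open Scope ring_scope.

(* Integrating over the open half-line keeps the integrand away from x = 0,
   where 0 `^ 0 = 1 but 0 `^ r = 0 for every other r. For z > 0 the integral
   converges; elsewhere the value is unspecified. *)
Definition Gamma (R : realType) (z : R) : R :=
  \int[@lebesgue_measure R]_(x in `]0, +oo[%classic)
    (x `^ (z - 1) * expR (- x)).

(* The list of edges, each unordered pair ij being stored as (i, j) or (j, i)
   and repeated according to its multiplicity. Vertices are labelled from 1;
   the vertex set 1, ..., n is carried separately. *)
Definition multigraph := seq (nat * nat).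

Definition degree (G : multigraph) (s : nat) : nat :=
  (\sum_(e <- G) ((e.1 == s) + (e.2 == s)))%N.

Definition adjacent (G : multigraph) (i t : nat) : bool :=
  ((i, t) \in G) || ((t, i) \in G).

(* An edge is counted once, even if it is a loop or both its ends are
   neighbours of t. *)
Definition second_degree (G : multigraph) (t : nat) : nat :=
  count (fun e : nat * nat =>
    [&& e.1 != t, e.2 != t & adjacent G e.1 t || adjacent G e.2 t]) G.

Definition Y (n k : nat) (G : multigraph) : nat :=
  count (fun t => (k <= second_degree G t)%N) (iota 1 n).

Section BuckleyOsthus.
Variables (R : realType) (a : R).

(* Conditional probability that the edge of the new vertex t goes to the vertex
   s in 1, ..., t, given that the graph on 1, ..., t - 1 is G. *)
Definition attach_prob (t : nat) (G : multigraph) (s : nat) : R :=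
  if s == t then a / ((a + 1) * t%:R - 1)
  else ((degree G s)%:R - 1 + a) / ((a + 1) * t%:R - 1).

(* A finitely supported law is a list of (value, probability) pairs. *)
Definition BO_step (t : nat) (law : seq (multigraph * R)) :
    seq (multigraph * R) :=
  flatten [seq [seq ((t, s) :: x.1, x.2 * attach_prob t x.1 s) | s <- iota 1 t]
          | x <- law].

(* The law of the random multigraph on the vertices 1, ..., n; the value at
   n = 0 is irrelevant. *)
Fixpoint BO_law (n : nat) : seq (multigraph * R) :=
  match n with
  | 0 => [:: ([::], 1)]
  | 1 => [:: ([:: (1%N, 1%N)], 1)]
  | m.+1 => BO_step m.+1 (BO_law m)
  end.

Definition BO_expect (n : nat) (f : multigraph -> R) : R :=
  \sum_(x <- BO_law n) x.2 * f x.1.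

Lemma iota1S (n : nat) : iota 1 n.+1 = rcons (iota 1 n) n.+1.
Proof. by rewrite -cats1 -(add1n n) -(iotaD 1 n 1) addn1. Qed.

Lemma BO_law_support (n : nat) (x : multigraph * R) : x \in BO_law n ->
  map fst x.1 = rev (iota 1 n) /\
  all (fun e : nat * nat => (1 <= e.1 <= n)%N && (1 <= e.2 <= n)%N) x.1.
Proof.
elim: n x => [|[|n] IHn] x; [by rewrite inE => /eqP->..|].
move=> /flattenP[l /mapP[y /IHn[sy ay] ->] /mapP[s]].
rewrite mem_iota => /andP[s1 sn] ->; split.
  by rewrite iota1S rev_rcons map_cons sy.
rewrite [all _ _]/=.
rewrite leqnn s1 -ltnS sn /=; apply: sub_all ay => e /andP[].
by case/andP=> -> /leqW-> /andP[-> /leqW->].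
Qed.

Lemma sum_degree (G : multigraph) (n : nat) :
  all (fun e : nat * nat => (1 <= e.1 <= n)%N && (1 <= e.2 <= n)%N) G ->
  (\sum_(s <- iota 1 n) degree G s = (size G).*2)%N.
Proof.
have sum1 (i : nat) : (1 <= i <= n)%N ->
    (\sum_(s <- iota 1 n) (i == s) = 1)%N.
  move=> iP; rewrite (bigD1_seq i) ?iota_uniq ?mem_iota ?add1n ?ltnS //= eqxx.
  by rewrite big1 // => s; rewrite eq_sym => /negbTE->.
elim: G => [|e G IHG] /=; first by rewrite big1 // => s _; rewrite /degree big_nil.
case/andP=> /andP[/sum1 e1 /sum1 e2] /IHG {}IHG.
under eq_bigr do rewrite /degree big_cons.
by rewrite !big_split /= e1 e2 IHG.
Qed.

Lemma BO_denom_gt0 (t : nat) : 0 < a -> 0 < (a + 1) * t.+1%:R - 1.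
Proof.
move=> a0; rewrite subr_gt0 mulrDl mul1r ltr_pwDl ?ler1n //.
by rewrite mulr_gt0 // ltr0n.
Qed.

Lemma BO_law_ge0 (n : nat) (x : multigraph * R) :
  0 < a -> x \in BO_law n -> 0 <= x.2.
Proof.
move=> a0; elim: n x => [|[|n] IHn] x; [by rewrite inE => /eqP->..|].
move=> /flattenP[l /mapP[y yn ->] /mapP[s]].
rewrite mem_iota => /andP[s1 sn] -> /=; rewrite mulr_ge0 ?IHn //.
rewrite /attach_prob; case: eqP => [_|/eqP sNn].
  by rewrite divr_ge0 ?ltW // BO_denom_gt0.
rewrite divr_ge0 ?(ltW (BO_denom_gt0 _ a0)) // addr_ge0 ?(ltW a0) //.
rewrite subr_ge0 ler1n /degree.
have yn' : y \in BO_law n.+1 by [].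
have : s \in map fst y.1.
  rewrite (proj1 (BO_law_support yn')) mem_rev mem_iota s1 add1n /=.
  by move: sn; rewrite add1n ltnS leq_eqVlt (negbTE sNn).
case/mapP=> e ey se; rewrite (big_rem e ey) /= -se eqxx.
by rewrite add1n addSn.
Qed.

Lemma BO_law_sum1 (n : nat) : 0 < a -> \sum_(x <- BO_law n) x.2 = 1.
Proof.
move=> a0; elim: n => [|[|n] IHn]; [by rewrite big_seq1..|].
rewrite -[BO_law _]/(BO_step n.+2 (BO_law n.+1)) /BO_step.
rewrite big_flatten big_map -[RHS]IHn big_seq [RHS]big_seq.
apply: eq_bigr => x xn; rewrite big_map.
have /BO_law_support[sG aG] : x \in BO_law n.+1 by [].
rewrite -mulr_sumr -[RHS]mulr1; congr (_ * _).
have {}sG : size x.1 = n.+1 by rewrite -(size_map fst) sG size_rev size_iota.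
have D0 := lt0r_neq0 (BO_denom_gt0 n.+1 a0).
rewrite iota1S big_rcons /= {2}/attach_prob eqxx.
rewrite (_ : \sum_(s <- iota 1 n.+1) _ =
  \sum_(s <- iota 1 n.+1)
    ((degree x.1 s)%:R + (a - 1)) / ((a + 1) * n.+2%:R - 1)).
  rewrite -mulr_suml big_split -natr_sum sum_degree // sG.
  rewrite big_const_seq count_predT size_iota iter_addr_0.
  rewrite -mulr_natr -muln2 natrM -mulrDl -[RHS](divff D0); congr (_ / _).
  by rewrite /= -[(a - 1) *+ _]mulr_natr [n.+2%:R]mulrS; ring.
apply: eq_big_seq => s; rewrite mem_iota add1n => /andP[_ sn].
by rewrite /attach_prob ltn_eqF // addrAC addrA.
Qed.

End BuckleyOsthus.

(* Main.v *)
Require Import Defs.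
From mathcomp Require Import all_boot all_order all_algebra.
From mathcomp Require Import all_classical all_reals all_analysis.
From mathcomp Require Import measurable_realfun zify ring lra.

Set Implicit Arguments.
Unset Strict Implicit.
Unset Printing Implicit Defensive.

Import Order.TTheory GRing.Theory Num.Theory.
Import numFieldNormedType.Exports.

Local Open Scope classical_set_scope.
Local Open Scope ring_scope.

(** Each vertex t that is not a root has one parent, and its second degree lies
between D - 1 and D + Z + 1, where D is the indegree of the parent and Z is the
number of grandchildren of t ([second_degree_ge], [second_degree_le]). The
main contribution to E Y_n(k) therefore comes from the vertices whose parent
has indegree at least k. Counted by parents, their number is the sum of
indeg s over the vertices s with indeg s >= k ([sum_indeg_parent]).

The expected number of vertices of indegree i obeys a linear recurrence in n
that has an exact solution limdeg i * (n + a / (a + 1)). The deviation from it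
is O(1 / (i + a)), uniformly in n ([expdeg_err]), so the expected sum above is
n * limtail k + O(k) ([exptail_asymp]). The numbers limtail k are quotients of
Gamma functions up to a rational factor, and by Wendel's inequality
([Gamma_shift_le], [Gamma_shift_ge]) they are
Gamma(2a+1) (a+1) / Gamma(a+1) * k^(-a) * (1 + O(1/k)) ([limtail_asymp]).

Three corrections remain, each of them to be bounded by a constant times
n k^(-1-a) (ln k)^e + k with e = ceil (a + 1).
 - Roots: there are O(1 + ln n) of them on average ([roots_small]).
 - Vertices with Z >= k / 2: Z has moments of the size of the powers of
   (n/t)^(1/(a+1)) (1 + ln (n/t)), so these vertices are essentially the ones
   born before n (ln k / k)^(1+a) ([tail_sum]).
 - Vertices with k / 2 <= D < k where Z makes up the deficit: the probability
   that D = j decays as j^(-1-a), and the deficit i is at most Z. Summed over i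
   and t this costs two logarithms ([middle_sum]).

The moments of Z, also jointly with the event D = j, come from a Lyapunov
function: a rising factorial of (Z + theta * (c + a)) / L, where c is the number
of children of t ([lyapunov_step]). Its expectation is propagated from the birth
of t, with a child weight theta that decreases to 0 at time n, so that in the end
only grandchildren are counted ([exp_potential_total],
[exp_potential_joint]). *)

(** * The Gamma function *)

Section GammaFunction.
Variable R : realType.
Local Notation mu := (@lebesgue_measure R).
Local Notation D := (`]0, +oo[%classic : set R).

Definition gamma_integrand (s x : R) : R := x `^ s * expR (- x).

(** The function s ln x - x / 2 is bounded above, with maximum at x = 2 s, so
half of the exponential absorbs the power. *)
Lemma gamma_integrand_le_exp (s : R) : 0 < s ->
  exists2 M : R, 0 < M & forall x : R, 0 <= x -> gamma_integrand s x <= M * expR (- (x / 2)).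
Proof.
move=> s0; exists (expR (s * ln (2 * s))) => [|x]; first exact: expR_gt0.
rewrite le_eqVlt => /predU1P[<-|x0].
  by rewrite /gamma_integrand powR0 ?gt_eqF// mul0r mulr_ge0 ?expR_ge0.
rewrite /gamma_integrand /powR gt_eqF// -!expRD ler_expR.
have : ln (x / (2 * s)) <= x / (2 * s).
  by rewrite ltW// ln_sublinear// divr_gt0// mulr_gt0.
rewrite ln_div ?posrE ?mulr_gt0// lerBlDr.
move=> /(ler_wpM2l (ltW s0)).
suff -> : s * (x / (2 * s) + ln (2 * s)) = x / 2 + s * ln (2 * s) by lra.
by field; rewrite gt_eqF.
Qed.

(** The fundamental theorem of calculus on the half-line. The integrand being
nonnegative, a finite limit of the primitive at infinity already makes it
integrable. *)
Lemma FTC2y_integrable (f F : R -> R) :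
  (forall x : R, 0 <= x -> 0 <= f x) ->
  {in `]0, +oo[, continuous f} -> f x @[x --> 0^'+] --> f 0 ->
  F x @[x --> +oo%R] --> 0 ->
  (forall x : R, 0 < x -> is_derive x 1 F (f x)) -> F x @[x --> 0^'+] --> F 0 ->
  mu.-integrable D (EFin \o f) /\ \int[mu]_(x in D) f x = - F 0.
Proof.
move=> f0 cf cf0 Foo dF cF0.
have mf : measurable_fun D f.
  apply: open_continuous_measurable_fun => //.
  exact/in_continuous_mksetP.
have mEf : measurable_fun D (EFin \o f) by exact/measurable_EFinP.
have I : (\int[mu]_(x in D) (f x)%:E = (- F 0)%:E)%E.
  rewrite integral_itv_obnd_cbnd//.
  rewrite (@ge0_continuous_FTC2y _ f F 0 0)// ?sub0e//.
  - exact/continuous_within_itvcyP.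
  - by move=> x /dF[].
  - move=> x; rewrite in_itv/= andbT => x0.
    by rewrite derive1E; have [_ ->] := dF _ x0.
split; last by rewrite /Rintegral I.
apply/integrableP; split => //.
under eq_integral => x xD.
  rewrite /= ger0_norm; last first.
    by apply: f0; move: xD; rewrite inE/= in_itv/= andbT => /ltW.
  over.
by rewrite I ltry.
Qed.

Lemma cvg_expN2 : expR (- (x / 2)) @[x --> +oo%R] --> (0 : R).
Proof.
rewrite (_ : (fun x => _) = (fun z => expR (- z)) \o (fun z : R => z / 2))//.
apply: (@cvg_comp _ _ _ _ _ _ (pinfty_nbhs R)); last exact: cvgr_expR.
by apply: gt0_cvgMly => //; rewrite invr_gt0.
Qed.

Lemma continuous_expRN : continuous (fun x : R => expR (- x)).
Proof.
by move=> x; apply: continuous_comp; [exact: oppr_continuous|exact: continuous_expR].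
Qed.

Lemma continuous_expRN2 : continuous (fun x : R => expR (- (x / 2))).
Proof.
move=> x; apply: continuous_comp; last exact: continuous_expR.
apply: (@continuousN _ R^o); exact: mulrr_continuous.
Qed.

Lemma expN2_integral : mu.-integrable D (EFin \o (fun x => expR (- (x / 2)))) /\
  \int[mu]_(x in D) expR (- (x / 2)) = 2.
Proof.
have c := continuous_expRN2.
have := @FTC2y_integrable (fun x => expR (- (x / 2)))
   (fun x => - 2 * expR (- (x / 2))).
rewrite mul0r oppr0 expR0 mulr1 opprK; apply.
- by move=> x _; exact: expR_ge0.
- by move=> x _; exact: c.
- by have := c 0; rewrite /continuous_at mul0r oppr0 expR0; exact: cvg_at_right_filter.
- rewrite -[0 in X in _ --> X](mulr0 (- 2)).
  by apply: cvgMr; exact: cvg_expN2.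
- move=> x x0; apply: is_derive_eq; rewrite /GRing.scale/=; lra.
- rewrite -[X in _ --> X](mulr1 (- 2)); apply: cvgMr.
  by have := c 0; rewrite /continuous_at mul0r oppr0 expR0; exact: cvg_at_right_filter.
Qed.

Lemma gamma_integrand_integrable (s : R) : 0 < s -> mu.-integrable D (EFin \o gamma_integrand s).
Proof.
move=> s0; have [M M0 hM] := gamma_integrand_le_exp s0.
apply: (@le_integrable _ _ _ mu D _ _ (EFin \o (fun x => M * expR (- (x / 2))))) => //.
- apply/measurable_EFinP/measurable_funM.
    by apply: measurable_funTS; exact: measurable_powR.
  apply: measurable_funTS; apply: continuous_measurable_fun.
  exact: continuous_expRN.
- move=> x /=; rewrite in_itv/= andbT => /ltW x0.
  rewrite lee_fin ger0_norm ?mulr_ge0 ?powR_ge0 ?expR_ge0//.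
  by rewrite ger0_norm ?hM// mulr_ge0 ?expR_ge0 ?ltW.
- rewrite (_ : _ \o _ = (fun x => M%:E * (EFin \o (fun x => expR (- (x / 2)))) x)%E)//.
  by apply: integrableZl => //; exact: (expN2_integral).1.
Qed.

Lemma GammaE (z : R) : Gamma z = \int[mu]_(x in D) gamma_integrand (z - 1) x.
Proof. by []. Qed.

(** Integration by parts, in the form of a primitive for the derivative of
[gamma_integrand z]. That derivative changes sign, so a multiple of
exp (- x / 2), large enough to make it nonnegative, is added to it before
[FTC2y_integrable] applies, and its integral is subtracted afterwards. The
bound 1 < z keeps both integrands bounded near 0. *)
Lemma Gamma_rec (z : R) : 1 < z -> Gamma (z + 1) = z * Gamma z.
Proof.
move=> z1; have z0 : 0 < z := lt_trans ltr01 z1.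
have z10 : 0 < z - 1 by rewrite subr_gt0.
have [M M0 hM] := gamma_integrand_le_exp z10; have [M' M'0 hM'] := gamma_integrand_le_exp z0.
pose c := M * z.
pose f x := gamma_integrand z x - z * gamma_integrand (z - 1) x + c * expR (- (x / 2)).
pose F x := - gamma_integrand z x - 2 * c * expR (- (x / 2)).
have c0 : 0 < c by rewrite mulr_gt0.
have ce := continuous_expRN2.
have ce0 : expR (- (x / 2)) @[x --> 0^'+] --> (1 : R).
  by have := ce 0; rewrite /continuous_at mul0r oppr0 expR0; exact: cvg_at_right_filter.
have cE0 : expR (- x) @[x --> 0^'+] --> (1 : R).
  have := @continuous_expRN 0.
  by rewrite /continuous_at oppr0 expR0; exact: cvg_at_right_filter.
have gd (s x : R) : 0 < x ->
    is_derive x 1 (gamma_integrand s) (s * gamma_integrand (s - 1) x - gamma_integrand s x).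
  move=> x0; have dp := is_derive1_powR s x0.
  rewrite /gamma_integrand; apply: is_derive_eq; rewrite /GRing.scale/=; ring.
have gc (s : R) : {in `]0, +oo[, continuous (gamma_integrand s)}.
  move=> x; rewrite in_itv/= andbT => /(gd s)[dx _].
  by apply: differentiable_continuous; exact/derivable1_diffP.
have gc0 (s : R) : 0 < s -> gamma_integrand s x @[x --> 0^'+] --> gamma_integrand s 0.
  move=> s0; rewrite {2}/gamma_integrand powR0 ?gt_eqF// mul0r -[X in _ --> X](mul0r 1).
  by apply: cvgM => //; exact: powR_cvg0.
have [If Ef] : mu.-integrable D (EFin \o f) /\ \int[mu]_(x in D) f x = - F 0.
  apply: FTC2y_integrable.
  - move=> x x0; rewrite /f; have := hM _ x0; have := powR_ge0 x z.
    have := expR_ge0 (- x); move=> e0 p0 hx.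
    have : 0 <= gamma_integrand z x by rewrite mulr_ge0.
    have : z * gamma_integrand (z - 1) x <= z * (M * expR (- (x / 2))) by rewrite ler_pM2l.
    by rewrite /c; lra.
  - move=> x x0; rewrite /continuous_at /f; apply: cvgD; last by apply: cvgMr; exact: ce.
    by apply: cvgB; [exact: gc|apply: cvgMr; exact: gc].
  - apply: cvgD; last first.
      by apply: cvgMr; rewrite mul0r oppr0 expR0; exact: ce0.
    apply: cvgB; first exact: gc0.
    by apply: cvgMr; exact: gc0.
  - rewrite [X in _ --> X](_ : 0 = - 0 - 2 * c * 0); last by rewrite mulr0 oppr0 addr0.
    apply: cvgB; last by apply: cvgMr; exact: cvg_expN2.
    apply: cvgN; apply: (@squeeze_cvgr _ _ _ _ (fun=> 0) (fun x => M' * expR (- (x / 2)))).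
    + near=> x; apply/andP; split.
        by rewrite mulr_ge0 ?powR_ge0 ?expR_ge0.
      by apply: hM'; near: x; apply: nbhs_pinfty_ge; exact: num_real.
    + exact: cvg_cst.
    + by rewrite -[X in _ --> X](mulr0 M'); apply: cvgMr; exact: cvg_expN2.
  - move=> x x0; have := gd z _ x0 => dz; rewrite /F; apply: is_derive_eq.
    rewrite /GRing.scale/= /f; lra.
  - apply: cvgB; first by apply: cvgN; exact: gc0.
    by apply: cvgMr; rewrite mul0r oppr0 expR0; exact: ce0.
have [Ie Ee] := expN2_integral.
have Iz := gamma_integrand_integrable z0; have Iz1 := gamma_integrand_integrable z10.
have mD : measurable D by exact: measurable_itv.
have IZ (k : R) (g : R -> R) : mu.-integrable D (EFin \o g) ->
    mu.-integrable D (EFin \o (fun x => k * g x)).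
  move=> ig; rewrite (_ : _ \o _ = (fun x => k%:E * (EFin \o g) x)%E)//.
  exact: integrableZl.
have : \int[mu]_(x in D) f x =
   \int[mu]_(x in D) gamma_integrand z x - z * \int[mu]_(x in D) gamma_integrand (z - 1) x + c * 2.
  rewrite /f RintegralD//; last 2 first.
  - rewrite (_ : _ \o _ = ((EFin \o gamma_integrand z) \-
      (EFin \o (fun x => (z * gamma_integrand (z - 1) x)%R)))%E) //.
    by apply: integrableB => //; exact: IZ.
  - exact: IZ.
  rewrite RintegralB//; last exact: IZ.
  by rewrite !RintegralZl// Ee.
rewrite Ef /F {1}/gamma_integrand powR0 ?gt_eqF// !mul0r oppr0 expR0 !GammaE addrK.
move=> h; lra.
Unshelve. all: by end_near. Qed.

(** This is the weighted inequality between the geometric and the arithmetic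
mean of u and 1. With m the arithmetic mean, it is the weighted sum of the
inequality ln y <= y - 1 at y = u / m and at y = 1 / m. *)
Lemma powR_le_tangent (s u : R) : 0 <= s <= 1 -> 0 <= u -> u `^ s <= 1 - s + s * u.
Proof.
move=> /andP[s0 s1]; rewrite le_eqVlt => /predU1P[<-|u0].
  rewrite mulr0 addr0; have [->|sn0] := eqVneq s 0; first by rewrite powRr0 subr0.
  by rewrite powR0// subr_ge0.
pose m := 1 - s + s * u.
have m0 : 0 < m.
  rewrite /m; move: s0; rewrite le_eqVlt => /predU1P[<-|s0]; first by lra.
  by rewrite ltr_wpDl ?subr_ge0// mulr_gt0.
have l1 : ln (u / m) <= u / m - 1.
  rewrite -[X in ln X](addrNK 1) addrC le_ln1Dx//.
  by have := divr_gt0 u0 m0; lra.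
have l2 : ln (m^-1) <= m^-1 - 1.
  rewrite -[X in ln X](addrNK 1) addrC le_ln1Dx//.
  by have : 0 < m^-1 by [rewrite invr_gt0]; lra.
rewrite /powR gt_eqF// -[leRHS]lnK ?posrE// ler_expR.
move: l1 l2; rewrite ln_div// lnV// => l1 l2.
have e : s * (u / m) + (1 - s) * m^-1 = 1 by rewrite /m; field; rewrite gt_eqF.
have : 0 <= 1 - s by lra.
by move=> s1'; have := ler_wpM2l s0 l1; have := ler_wpM2l s1' l2; nra.
Qed.

Lemma Gamma_gt0 (z : R) : 1 < z -> 0 < Gamma z.
Proof.
move=> z1; have z0 : 0 < z - 1 by rewrite subr_gt0.
have Iz := gamma_integrand_integrable z0.
rewrite GammaE; apply: (@lt_le_trans _ _ (\int[mu]_(x in `[1, 2]%classic) expR (-2))).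
  rewrite Rintegral_cst//= lebesgue_measure_itv/= lte_fin ltr1n/=.
  by rewrite mulr_gt0 ?expR_gt0// subr_gt0 ltr1n.
have sub : `[1, 2]%classic `<=` D.
  by move=> x /=; rewrite !in_itv/= andbT => /andP[+ _]; exact: lt_le_trans.
have lb (x : R) : `[1, 2]%classic x -> expR (-2) <= gamma_integrand (z - 1) x.
  rewrite /= in_itv/= => /andP[x1 x2].
  rewrite /gamma_integrand -[leLHS]mul1r ler_pM ?expR_ge0// ?ler_expR ?lerN2//.
  by apply: le_trans (ler_powR x1 (ltW z0)); rewrite powRr0.
have I12 : mu.-integrable `[1, 2]%classic (EFin \o gamma_integrand (z - 1)).
  exact: integrableS Iz.
apply: (@le_trans _ _ (\int[mu]_(x in `[1, 2]%classic) gamma_integrand (z - 1) x)).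
  apply: le_Rintegral => //.
  apply: (@le_integrable _ _ _ mu _ _ _ (EFin \o gamma_integrand (z - 1))) => //.
    exact/measurable_EFinP.
  move=> x /lb hx; rewrite /= lee_fin !ger0_norm ?expR_ge0//.
  by rewrite mulr_ge0 ?powR_ge0 ?expR_ge0.
rewrite /Rintegral fine_le//.
- exact: integrable_fin_num.
- exact: integrable_fin_num.
- apply: ge0_subset_integral => //.
    exact: (measurable_int mu).
  by move=> x _; rewrite lee_fin mulr_ge0 ?powR_ge0 ?expR_ge0.
Qed.

(** Wendel's inequality. The bound (t / x)^s <= 1 - s + s (t / x) is integrated
against the Gamma density of parameter x, whose mean is x by [Gamma_rec], so
that the right-hand side integrates to 1. *)
Lemma Gamma_shift_le (x s : R) : 1 < x -> 0 <= s <= 1 ->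
  Gamma (x + s) <= x `^ s * Gamma x.
Proof.
move=> x1 s01; have x0 : 0 < x := lt_trans ltr01 x1.
have Ix := @gamma_integrand_integrable (x - 1) ltac:(by rewrite subr_gt0).
have Ix1 := gamma_integrand_integrable x0.
have Is := @gamma_integrand_integrable (x + s - 1) ltac:(lra).
have mD : measurable D by exact: measurable_itv.
have IZ (k : R) (g : R -> R) : mu.-integrable D (EFin \o g) ->
    mu.-integrable D (EFin \o (fun x => k * g x)).
  move=> ig; rewrite (_ : _ \o _ = (fun x => k%:E * (EFin \o g) x)%E)//.
  exact: integrableZl.
have -> : x `^ s * Gamma x = \int[mu]_(t in D)
    (x `^ s * (1 - s) * gamma_integrand (x - 1) t + x `^ s * (s / x) * gamma_integrand x t).
  rewrite RintegralD//; [|exact: IZ|exact: IZ].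
  rewrite !RintegralZl//.
  have := Gamma_rec x1; rewrite !GammaE addrK => ->.
  by field; rewrite gt_eqF.
rewrite GammaE; apply: le_Rintegral => //.
  rewrite (_ : _ \o _ = ((EFin \o (fun t => (x `^ s * (1 - s) * gamma_integrand (x - 1) t)%R)) \+
     (EFin \o (fun t => (x `^ s * (s / x) * gamma_integrand x t)%R)))%E)//.
  by apply: integrableD => //; exact: IZ.
move=> t /=; rewrite in_itv/= andbT => t0.
have := @powR_le_tangent s (t / x) s01 (ltW (divr_gt0 t0 x0)).
have e : (t / x) `^ s * x `^ s = t `^ s.
  by rewrite -powRM ?(ltW x0) ?divr_ge0 ?ltW// divfK// gt_eqF.
move/(ler_wpM2r (powR_ge0 x s)); rewrite e => h.
have -> : gamma_integrand (x + s - 1) t = t `^ s * gamma_integrand (x - 1) t.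
  rewrite (_ : x + s - 1 = s + (x - 1)); last by ring.
  have e2 : t `^ (s + (x - 1)) = t `^ s * t `^ (x - 1).
    by rewrite powRD// (gt_eqF t0) implybT.
  by rewrite /gamma_integrand e2 mulrA.
have g0 : 0 <= gamma_integrand (x - 1) t by rewrite mulr_ge0 ?powR_ge0 ?expR_ge0.
apply: (le_trans (ler_wpM2r g0 h)).
rewrite le_eqVlt; apply/orP; left; apply/eqP.
have -> : gamma_integrand x t = t * gamma_integrand (x - 1) t.
  by rewrite /gamma_integrand mulrA mulr_powRB1 ?(ltW t0)//.
by field; rewrite gt_eqF.
Qed.

(** The lower bound that complements [Gamma_shift_le] is that lemma itself for
the remaining shift 1 - s from x + s to x + 1. *)
Lemma Gamma_shift_ge (x s : R) : 1 < x -> 0 <= s <= 1 ->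
  x / (x + s) * x `^ s * Gamma x <= Gamma (x + s).
Proof.
move=> x1 /andP[s0 s1]; have x0 : 0 < x := lt_trans ltr01 x1.
have xs0 : 0 < x + s by lra.
have := @Gamma_shift_le (x + s) (1 - s) ltac:(lra) ltac:(lra).
have -> : x + s + (1 - s) = x + 1 by ring.
rewrite Gamma_rec// => h.
have h2 : (x + s) `^ (1 - s) * x `^ s <= x + s.
  rewrite (@le_trans _ _ ((x + s) `^ (1 - s) * (x + s) `^ s))//.
    by rewrite ler_wpM2l ?powR_ge0// ge0_ler_powR ?nnegrE ?(ltW x0) ?(ltW xs0)// lerDl.
  rewrite -powRD; last by rewrite (gt_eqF xs0) implybT.
  by rewrite subrK powRr1// ltW.
have g0 : 0 < Gamma (x + s) by apply: Gamma_gt0; lra.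
rewrite (_ : x / (x + s) * _ * _ = x * Gamma x * x `^ s / (x + s)); last by ring.
rewrite ler_pdivrMr//.
apply: (le_trans (ler_wpM2r (powR_ge0 x s) h)).
by rewrite mulrAC mulrC ler_wpM2l// ltW.
Qed.

(** Shifts in [0, 1] are covered by Wendel's inequality, and each further unit
shift multiplies the ratio by 1 + (s - 1) / x, which is at least 1 and is
1 + O(1 / x). The lower bound 1 / 2 makes it possible to divide by the
ratio. *)
Lemma Gamma_ratio (s : R) : 0 <= s -> exists2 C : R, 0 <= C & forall x : R, 1 < x ->
  2^-1 <= Gamma (x + s) / (x `^ s * Gamma x) /\
  `|Gamma (x + s) / (x `^ s * Gamma x) - 1| <= C / x.
Proof.
move=> s0; have [N] : exists N : nat, s <= N.+1%:R.
  by exists (Num.bound s); rewrite (le_trans (ltW (archi_boundP s0)))// ler_nat.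
elim: N s s0 => [|N IH] s s0 sN.
  exists 1 => // x x1; have x0 : 0 < x := lt_trans ltr01 x1.
  have s01 : 0 <= s <= 1 by rewrite s0.
  have d0 : 0 < x `^ s * Gamma x by rewrite mulr_gt0 ?powR_gt0 ?Gamma_gt0.
  have := Gamma_shift_le x1 s01; have := Gamma_shift_ge x1 s01.
  rewrite -mulrA -ler_pdivlMr// => lo; rewrite -[X in _ <= X]mul1r -ler_pdivrMr// => hi.
  set y := Gamma _ / _ in lo hi *.
  have xs0 : 0 < x + s by lra.
  have h1 : 2^-1 <= x / (x + s) by rewrite ler_pdivlMr//; lra.
  have h2 : 1 - 1 / x <= x / (x + s).
    rewrite ler_pdivlMr// mulrBl mul1r.
    have : 1 <= 1 / x * (x + s) by rewrite mulrAC ler_pdivlMr// mul1r; lra.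
    lra.
  split; first exact: le_trans lo.
  by rewrite ler_norml; apply/andP; split; [lra|have := divr_gt0 ltr01 x0; lra].
have [s1|s1] := leP s 1.
  by apply: IH => //; rewrite (le_trans s1)// ler1n.
have s10 : 0 <= s - 1 by lra.
have s1N : s - 1 <= N.+1%:R by move: sN; rewrite -[N.+2%:R]natr1; lra.
have [C C0 hC] := IH _ s10 s1N.
exists (C + (s - 1) * (1 + C)); first by rewrite addr_ge0// mulr_ge0; lra.
move=> x x1; have x0 : 0 < x := lt_trans ltr01 x1.
have [{hC} lo up] := hC _ x1; clear IH s1N sN.
have g0 := Gamma_gt0 x1.
have p0 := powR_gt0 (s - 1) x0.
have -> : Gamma (x + s) / (x `^ s * Gamma x) =
   (1 + (s - 1) / x) * (Gamma (x + (s - 1)) / (x `^ (s - 1) * Gamma x)).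
  rewrite (_ : x + s = x + (s - 1) + 1); last by ring.
  rewrite Gamma_rec; last by lra.
  rewrite -(@mulr_powRB1 _ x s) ?ltW//; last by lra.
  by field; rewrite !gt_eqF.
move: lo up; move: (Gamma _ / _) => y lo up.
have sx : 0 <= (s - 1) / x by rewrite divr_ge0; lra.
have y1 : y <= 1 + C.
  have : C / x <= C by rewrite ler_pdivrMr// ler_peMr// ltW.
  by move: up; rewrite ler_norml => /andP[_]; lra.
split; first by rewrite (le_trans lo)// ler_peMl ?lerDl//; lra.
rewrite (_ : _ - 1 = (y - 1) + (s - 1) / x * y); last by ring.
apply: (le_trans (ler_normD _ _)); rewrite [leRHS]mulrDl; apply: lerD => //.
have y0 : 0 <= y by lra.
rewrite ger0_norm; last exact: mulr_ge0.
rewrite mulrAC; apply: ler_wpM2r; first by rewrite invr_ge0 ltW.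
by rewrite ler_wpM2l.
Qed.
End GammaFunction.

(** * The limiting degree sequence *)

Section DegreeSequence.
Variables (R : realType) (a : R).

(** The limiting proportion of vertices of indegree i: the recurrence says that
the numbers of vertices entering and leaving each indegree class balance when
all classes grow linearly in time. *)
Fixpoint limdeg (i : nat) : R :=
  if i is j.+1 then (j%:R + a) / (j.+1%:R + 2 * a + 1) * limdeg j
  else (a + 1) / (2 * a + 1).
Arguments limdeg : simpl never.

Lemma limdegS i : limdeg i.+1 = (i%:R + a) / (i.+1%:R + 2 * a + 1) * limdeg i.
Proof. by []. Qed.

(** Up to the factor a + 1, this is the limiting probability that the parent of
the newest vertex has indegree j once that vertex is attached; see [limparS].
Written in terms of [limdeg j] it makes sense at j = 0 as well and satisfies
the recurrence [limpar_rec] from there on. *)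
Definition limpar (j : nat) : R := (j%:R + 2 * a + 1) * limdeg j.

(** A closed form for the sum of i * limdeg i over all i >= k, found by
telescoping; [sum_limdeg] identifies it. *)
Definition limtail (k : nat) : R := (k%:R + a / (a + 1)) * limpar k / a.

Lemma nat_shift_gt0 (i : nat) (x : R) : 0 < x -> 0 < i%:R + x.
Proof. by move=> x0; rewrite ltr_wpDl. Qed.

Lemma limdeg_gt0 (a0 : 0 < a) i : 0 < limdeg i.
Proof.
elim: i => [|i IH]; first by apply: divr_gt0; lra.
rewrite limdegS mulr_gt0// divr_gt0 ?nat_shift_gt0//.
by rewrite -addrA nat_shift_gt0//; lra.
Qed.

Lemma limpar_gt0 (a0 : 0 < a) j : 0 < limpar j.
Proof. by rewrite mulr_gt0 ?(limdeg_gt0 a0)// -addrA nat_shift_gt0//; lra. Qed.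

Lemma limparS (a0 : 0 < a) j : limpar j.+1 = (j%:R + a) * limdeg j.
Proof.
rewrite /limpar limdegS mulrA mulrCA divff ?mulr1// gt_eqF//.
by rewrite -addrA nat_shift_gt0//; lra.
Qed.

Lemma limpar_rec (a0 : 0 < a) j : (j%:R + 2 * a + 1) * limpar j.+1 = (j%:R + a) * limpar j.
Proof. by rewrite (limparS a0) /limpar; ring. Qed.

Lemma limpar_decr (a0 : 0 < a) j : limpar j.+1 <= limpar j.
Proof.
rewrite -(@ler_pM2l _ (j%:R + 2 * a + 1)); last by rewrite -addrA nat_shift_gt0//; lra.
by rewrite (limpar_rec a0) ler_pM2r ?(limpar_gt0 a0)//; lra.
Qed.

Lemma limpar_homo (a0 : 0 < a) i j : (i <= j)%N -> limpar j <= limpar i.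
Proof.
move=> /subnK <-; elim: (j - i)%N => [|m IH] //.
by rewrite addSn (le_trans (limpar_decr a0 _)).
Qed.

(** By [limpar_rec] the products j * limpar j do not increase from j = 1 on,
where the value is below a. *)
Lemma limpar_le_inv (a0 : 0 < a) j : j.+1%:R * limpar j.+1 <= a.
Proof.
elim: j => [|j IH].
  rewrite mul1r (limparS a0) /limdeg add0r ger_pMr// ler_pdivrMr; lra.
apply: le_trans IH.
rewrite -(@ler_pM2l _ (j.+1%:R + 2 * a + 1)); last by rewrite -addrA nat_shift_gt0//; lra.
rewrite mulrCA (limpar_rec a0) -[j.+2%:R]natr1.
move: (limpar j.+1) (limpar_gt0 a0 j.+1) => P P0; rewrite !mulrA ler_pM2r//.
set x := j.+1%:R; have : 1 <= x by rewrite ler1n.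
nra.
Qed.

(** The sum telescopes: k * limdeg k = limtail k - limtail (k + 1). *)
Lemma sum_limdeg (a0 : 0 < a) k : \sum_(i < k.+1) i%:R * limdeg i = 1 - limtail k.+1.
Proof.
have an0 : a != 0 by rewrite gt_eqF.
have a1n0 : a + 1 != 0 by rewrite gt_eqF//; lra.
elim: k => [|k IH].
  rewrite big_ord1 mul0r /limtail (limparS a0) /limdeg; field.
  by rewrite a1n0 an0 gt_eqF//; lra.
rewrite big_ord_recr/= IH /limtail [limpar k.+2](limparS a0) [limpar k.+1]/limpar.
rewrite -[k.+2%:R]natr1; set x := k.+1%:R; set d := limdeg _.
by field; rewrite an0.
Qed.

Lemma powR1D (x : R) : 0 < x -> x `^ (1 + a) = x * x `^ a.
Proof. by move=> x0; rewrite powRD ?powRr1 ?(ltW x0)// (gt_eqF x0) implybT. Qed.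

Definition tail_const : R := (a + 1) * Gamma (2 * a + 1) / Gamma (a + 1).

Lemma tail_const_gt0 (a0 : 0 < a) : 0 < tail_const.
Proof. by rewrite divr_gt0 ?mulr_gt0 ?Gamma_gt0//; lra. Qed.

(** By [Gamma_rec] the quotient of Gamma functions obeys the recurrence
[limpar_rec], so only the constant has to be matched, at k = 1. *)
Lemma limpar_Gamma (a0 : 0 < a) k :
  limpar k.+1 = a * tail_const * (Gamma (k.+1%:R + a) / Gamma (k.+1%:R + (2 * a + 1))).
Proof.
have g1 : Gamma (a + 1) != 0 by rewrite gt_eqF// Gamma_gt0; lra.
elim: k => [|k IH].
  rewrite (limparS a0) /limdeg /tail_const add0r [1 + a]addrC [1 + (2 * a + 1)]addrC.
  rewrite (@Gamma_rec _ (2 * a + 1)); last by lra.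
  have : Gamma (2 * a + 1) != 0 by rewrite gt_eqF// Gamma_gt0; lra.
  move: (Gamma (a + 1)) (Gamma (2 * a + 1)) g1 => x y x0 y0.
  by field; rewrite x0 y0 gt_eqF//; lra.
have k0 : (0 : R) < k.+1%:R by rewrite ltr0n.
have k1 : (1 : R) <= k.+1%:R by rewrite ler1n.
have k2 : k.+1%:R + 2 * a + 1 != 0 by rewrite gt_eqF//; lra.
apply: (mulfI k2); rewrite (limpar_rec a0) IH -[k.+2%:R]natr1.
rewrite [k.+1%:R + 1 + a]addrAC [k.+1%:R + 1 + _]addrAC.
rewrite Gamma_rec; last by lra.
rewrite Gamma_rec; last by lra.
have : Gamma (k.+1%:R + (2 * a + 1)) != 0 by rewrite gt_eqF// Gamma_gt0; lra.
move: (Gamma _) tail_const (Gamma _) => x y z z0; rewrite -[_ + 2 * a + 1]addrA.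
rewrite -addrA in k2; clear IH k0 k1; move: (k.+1%:R) k2 => q k2.
by field; rewrite z0 k2.
Qed.

(** The quotient is a ratio of two instances of [Gamma_ratio] at k, one with
shift a and one with shift 2 a + 1. *)
Lemma limpar_asymp (a0 : 0 < a) : exists2 C : R, 0 < C & forall k, (1 < k)%N ->
  `|limpar k * (k%:R * k%:R `^ a) / (a * tail_const) - 1| <= C / k%:R.
Proof.
have [C1 C10 h1] := @Gamma_ratio R a (ltW a0).
have [C2 C20 h2] := @Gamma_ratio R (2 * a + 1) ltac:(lra).
exists (2 * (C1 + C2) + 1) => [|[|k] // k1]; first by lra.
have k1' : 1 < k.+1%:R :> R by rewrite ltr1n.
have k0 : 0 < k.+1%:R :> R by rewrite ltr0n.
have [_ u1] := h1 _ k1'; have [v0 v1] := h2 _ k1'.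
set u := _ / _ in u1; set v := _ / _ in v0 v1.
have -> : limpar k.+1 * (k.+1%:R * k.+1%:R `^ a) / (a * tail_const) = u / v.
  rewrite (limpar_Gamma a0) /u /v.
  have e : k.+1%:R `^ (2 * a + 1) = k.+1%:R `^ a * (k.+1%:R * k.+1%:R `^ a).
    rewrite -powR1D// -powRD; last by rewrite (gt_eqF k0) implybT.
    by congr (_ `^ _); ring.
  rewrite e.
  have := tail_const_gt0 a0; have := @Gamma_gt0 R k.+1%:R k1'.
  have := @Gamma_gt0 R (k.+1%:R + (2 * a + 1)) ltac:(lra).
  have := powR_gt0 a k0.
  move: (k.+1%:R `^ a) (Gamma (k.+1%:R + (2 * a + 1))) (Gamma (k.+1%:R + a))
    (Gamma k.+1%:R) tail_const => p x y z w p0 x0 z0 w0.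
  by field; rewrite !gt_eqF.
have v00 : 0 < v by apply: lt_le_trans v0; lra.
rewrite (_ : u / v - 1 = (u - v) / v); last by field; rewrite gt_eqF.
rewrite normrM normfV (gtr0_norm v00) ler_pdivrMr//.
have uv : `|u - v| <= (C1 + C2) / k.+1%:R.
  rewrite (_ : u - v = (u - 1) - (v - 1)); last by ring.
  by rewrite (le_trans (ler_normB _ _))// mulrDl lerD.
apply: (le_trans uv).
have : 0 <= k.+1%:R^-1 :> R by rewrite invr_ge0 ltW.
move: (k.+1%:R^-1) => q q0.
rewrite mulrAC ler_wpM2r//.
have : 0 <= C1 + C2 by rewrite addr_ge0.
nra.
Qed.

Lemma limpar_le_powR (a0 : 0 < a) : exists2 C : R, 0 < C & forall k, (0 < k)%N ->
  limpar k <= C / k%:R `^ (1 + a).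
Proof.
have [C C0 hC] := limpar_asymp a0; move: tail_const (tail_const_gt0 a0) hC => K K0 hC.
exists (a + a * K * (1 + C)) => [|k k0].
  exact: addr_gt0 a0 (mulr_gt0 (mulr_gt0 a0 K0) (addr_gt0 ltr01 C0)).
have k0' : 0 < k%:R :> R by rewrite ltr0n.
have p0 : 0 < k%:R `^ (1 + a) :> R by rewrite powR_gt0.
rewrite ler_pdivlMr//.
have [k1|k1] := leqP k 1.
  have -> : k = 1%N by apply/eqP; rewrite eqn_leq k1.
  rewrite powR1 mulr1; apply: (@le_trans _ _ a).
    by have := limpar_le_inv a0 0; rewrite mul1r.
  by rewrite lerDl ltW// mulr_gt0 ?addr_gt0 ?mulr_gt0.
have e : k%:R `^ (1 + a) = k%:R * k%:R `^ a :> R.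
  exact: powR1D.
rewrite e; have := hC _ k1; rewrite ler_norml => /andP[_].
rewrite lerBlDl ler_pdivrMr ?mulr_gt0// => /le_trans; apply.
have : C / k%:R <= C by rewrite ler_pdivrMr// ler_peMr ?(ltW C0)// ler1n.
have : 0 < a * K by rewrite mulr_gt0.
move: (a * K) (C / _) => x y x0 yC; nra.
Qed.

(** Since limtail k = (k + O(1)) * limpar k / a, this follows from
[limpar_asymp]. *)
Lemma limtail_asymp (a0 : 0 < a) : exists2 C : R, 0 < C & forall k, (1 < k)%N ->
  `|limtail k - tail_const / k%:R `^ a| <= C / k%:R `^ (1 + a).
Proof.
have [C C0 hC] := limpar_asymp a0; move: tail_const (tail_const_gt0 a0) hC => K K0 hC.
exists (K * (C + a * (1 + C))) => [|k k1].
  exact: mulr_gt0 K0 (addr_gt0 C0 (mulr_gt0 a0 (addr_gt0 ltr01 C0))).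
have k0 : 0 < k%:R :> R by rewrite ltr0n (ltn_trans _ k1).
have e : k%:R `^ (1 + a) = k%:R * k%:R `^ a :> R.
  exact: powR1D.
have p0 : 0 < k%:R `^ a :> R by rewrite powR_gt0.
have := hC _ k1; set rho := _ / _ => hr.
have -> : limtail k - K / k%:R `^ a =
    (K / k%:R `^ a) * ((rho - 1) + a / (a + 1) * rho / k%:R).
  rewrite /rho /limtail; move: (_ `^ _) p0 (limpar k) => p p0 f.
  by field; rewrite !gt_eqF//; lra.
rewrite e normrM gtr0_norm ?divr_gt0//.
rewrite [leRHS](_ : K * _ / (k%:R * k%:R `^ a) = K / k%:R `^ a * ((C + a * (1 + C)) / k%:R)); last first.
  by move: (_ `^ _) p0 => p p0; field; rewrite !gt_eqF.
rewrite ler_wpM2l ?(ltW (divr_gt0 K0 p0))//.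
apply: (le_trans (ler_normD _ _)); rewrite [leRHS]mulrDl; apply: lerD => //.
rewrite normrM normfV (gtr0_norm k0) ler_wpM2r ?invr_ge0 ?(ltW k0)//.
have b0 : 0 <= a / (a + 1) by rewrite divr_ge0; lra.
rewrite normrM ger0_norm//; apply: ler_pM => //; first by rewrite ler_pdivrMr; nra.
rewrite -[rho](subrK 1); apply: (le_trans (ler_normD _ _)).
rewrite normr1 addrC lerD2l (le_trans hr)// ler_pdivrMr// ler_peMr ?(ltW C0)//.
by rewrite ler1n ltnW.
Qed.
End DegreeSequence.

(** * Degrees and second degrees in a growing forest *)

Local Open Scope nat_scope.

(** The shape of every graph that the model produces. Edges are listed from the
newest to the oldest, the edge of a vertex goes to a vertex that is not newer,
and so the graph is a forest whose roots carry loops. *)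
Fixpoint increasing (G : multigraph) : bool :=
  if G is e :: G' then [&& e.1 == (size G').+1, 0 < e.2 <= e.1 & increasing G']
  else true.

(** The value 0, which is not a vertex, stands for the parent of a vertex that
is not present. *)
Fixpoint parent (G : multigraph) (v : nat) : nat :=
  if G is e :: G' then if e.1 == v then e.2 else parent G' v else 0.

(** The loop of a root counts once, so that the degree is always the indegree
plus one ([degree_indeg]) and the attachment weight is indegree plus a. *)
Definition indeg (G : multigraph) (v : nat) : nat := count (fun e => e.2 == v) G.

Definition is_child (G : multigraph) (t s : nat) : bool :=
  (parent G s == t) && (s != t).

Definition kids (G : multigraph) (t : nat) : nat :=
  count (fun e => (e.2 == t) && (e.1 != t)) G.

Definition grandkids (G : multigraph) (t : nat) : nat :=
  count (fun e => is_child G t e.2) G.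

Lemma increasing_fst G : increasing G -> map fst G = rev (iota 1 (size G)).
Proof.
elim: G => [|e G IH]//= /and3P[/eqP e1 _ /IH sG].
by rewrite sG e1 -[(_ :: _)]rev_rcons -iota1S.
Qed.

Lemma increasing_mem G e : increasing G -> e \in G ->
  (0 < e.2 <= e.1) && (e.1 <= size G).
Proof.
elim: G => [|x G IH]//= /and3P[/eqP x1 x2 iG]; rewrite inE => /predU1P[->|eG].
  by rewrite x2 x1 leqnn.
by have /andP[-> /leqW ->] := IH iG eG.
Qed.

Lemma mem_parent G v : increasing G -> 0 < v <= size G -> (v, parent G v) \in G.
Proof.
elim: G => [|x G IH] /=; first by case: v.
move=> /and3P[/eqP x1 x2 iG] /andP[v0 vn]; rewrite inE.
have [<-|xv] := eqVneq x.1 v; first by case: (x) => y z; rewrite eqxx.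
by rewrite IH ?orbT// v0; move: vn; rewrite leq_eqVlt -{1}x1 eq_sym (negbTE xv).
Qed.

Lemma parent_mem G e : increasing G -> e \in G -> parent G e.1 = e.2.
Proof.
elim: G => [|x G IH]//= /and3P[/eqP x1 x2 iG]; rewrite inE => /predU1P[->|eG].
  by rewrite eqxx.
have /andP[_ en] := increasing_mem iG eG.
by rewrite x1 gtn_eqF ?ltnS// IH.
Qed.

Lemma parent_bounds G v : increasing G -> 0 < v <= size G -> 0 < parent G v <= v.
Proof. by move=> iG vG; have /andP[] := increasing_mem iG (mem_parent iG vG). Qed.

Lemma parent_default G v : increasing G -> size G < v -> parent G v = 0.
Proof.
elim: G => [|x G IH]//= /and3P[/eqP x1 x2 iG] vn.
by rewrite x1 ltn_eqF// IH// ltnW.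
Qed.

Lemma mem_edge G x y : increasing G ->
  ((x, y) \in G) = (0 < x <= size G) && (parent G x == y).
Proof.
move=> iG; apply/idP/andP => [xy|[xG /eqP<-]]; last exact: mem_parent.
have /andP[/andP[/= y0 yx] xn] := increasing_mem iG xy.
by rewrite (parent_mem iG xy) xn (leq_trans y0 yx).
Qed.

(** Every vertex owns exactly one edge, the one to its parent. *)
Lemma big_vertices (M : Type) (idx : M) (op : Monoid.com_law idx) G
    (F : nat -> nat -> M) : increasing G ->
  \big[op/idx]_(v <- iota 1 (size G)) F v (parent G v) =
  \big[op/idx]_(e <- G) F e.1 e.2.
Proof.
move=> iG; transitivity (\big[op/idx]_(e <- G) F e.1 (parent G e.1)).
  rewrite -(big_map fst predT (fun v => F v (parent G v))).
  by rewrite increasing_fst//; apply: perm_big; rewrite perm_sym perm_rev.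
by rewrite big_seq [RHS]big_seq; apply: eq_bigr => e eG; rewrite (parent_mem iG eG).
Qed.

Lemma sum_indeg (R : pzSemiRingType) G m (w : nat -> R) : increasing G -> size G <= m ->
  (\sum_(s <- iota 1 m) (indeg G s)%:R * w s = \sum_(e <- G) w e.2)%R.
Proof.
move=> iG Gm; transitivity (\sum_(s <- iota 1 m) \sum_(e <- G | e.2 == s) w s)%R.
  apply: eq_bigr => s _; rewrite /indeg -sum1_count natr_sum mulr_suml.
  by apply: eq_bigr => e _; rewrite mul1r.
rewrite (exchange_big_dep predT)//= big_seq [RHS]big_seq; apply: eq_bigr => e eG.
have /andP[/andP[e0 e2] en] := increasing_mem iG eG.
rewrite big_mkcond (bigD1_seq e.2) ?iota_uniq//=; last first.
  by rewrite mem_iota e0 add1n ltnS; exact: leq_trans (leq_trans e2 en) Gm.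
by rewrite eqxx big1 ?addr0// => s; rewrite eq_sym => /negbTE->.
Qed.

Lemma count_fst G v : increasing G -> count (fun e => e.1 == v) G = (0 < v <= size G).
Proof.
move=> iG; rewrite -[LHS](count_map fst (pred1 v)) increasing_fst//.
rewrite count_uniq_mem ?rev_uniq ?iota_uniq// mem_rev mem_iota.
by rewrite add1n ltnS.
Qed.

Lemma indeg_default G v : increasing G -> size G < v -> indeg G v = 0.
Proof.
move=> iG vn; apply/eqP; rewrite -leqn0 leqNgt -has_count; apply/hasPn => e eG.
have /andP[/andP[_ e2] en] := increasing_mem iG eG.
by rewrite ltn_eqF// (leq_ltn_trans _ vn)// (leq_trans e2).
Qed.

Lemma degree_indeg G s : increasing G -> 0 < s <= size G ->
  degree G s = (indeg G s).+1.
Proof.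
move=> iG sG; rewrite /degree big_split/= -[RHS]add1n; congr (_ + _).
  transitivity (count (fun e => e.1 == s) G); last by rewrite count_fst// sG.
  by rewrite -sum1_count [RHS]big_mkcond/=; apply: eq_bigr => e _; case: eqP.
by rewrite /indeg -sum1_count [RHS]big_mkcond/=; apply: eq_bigr => e _; case: eqP.
Qed.

Lemma indeg_cons e G s : indeg (e :: G) s = (e.2 == s) + indeg G s.
Proof. by []. Qed.

Lemma indeg_le_size G s : indeg G s <= size G.
Proof. exact: count_size. Qed.

Lemma parent_cons G s v : v <= size G -> parent (((size G).+1, s) :: G) v = parent G v.
Proof. by move=> vG /=; rewrite gtn_eqF. Qed.

Lemma kids_cons G t s : t <= size G ->
  kids (((size G).+1, s) :: G) t = (s == t) + kids G t.
Proof. by move=> tG; rewrite /kids/= [_.+1 == t]gtn_eqF ?andbT. Qed.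

Lemma grandkids_cons G t s : increasing G -> 0 < t <= size G -> 0 < s <= (size G).+1 ->
  grandkids (((size G).+1, s) :: G) t = is_child G t s + grandkids G t.
Proof.
move=> iG /andP[t0 tG] /andP[s0 sG]; rewrite /grandkids/=; congr (_ + _).
  rewrite /is_child/=; have [<-|//] := eqVneq (size G).+1 s.
  by rewrite parent_default// gtn_eqF// ltn_eqF.
apply: eq_in_count => e eG; rewrite /is_child parent_cons//.
by have /andP[/andP[_ e2] en] := increasing_mem iG eG; exact: leq_trans en.
Qed.

Lemma indeg_kids G t : increasing G -> 0 < t <= size G -> parent G t != t ->
  indeg G t = kids G t.
Proof.
move=> iG tG tr; apply: eq_in_count => e eG; case: eqP => //= e2.
symmetry; apply: contraNneq tr => e1; rewrite -{1}e1 (parent_mem iG eG).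
exact/eqP.
Qed.

(** Children can be counted as vertices or as the edges that they own. *)
Lemma count_children G t m : increasing G -> 0 < t -> size G <= m ->
  count (is_child G t) (iota 1 m) = kids G t.
Proof.
move=> iG t0 Gm; rewrite -(subnKC Gm) iotaD count_cat.
rewrite [X in _ + X](_ : _ = 0) ?addn0.
  rewrite /kids -!sum1_count big_mkcond [RHS]big_mkcond/=.
  exact: (big_vertices _ (fun v p => if (p == t) && (v != t) then 1 else 0) iG).
apply/eqP; rewrite -leqn0 leqNgt -has_count; apply/hasPn => s.
rewrite mem_iota => /andP[Gs _]; rewrite /is_child parent_default//.
by rewrite [0 == t]ltn_eqF.
Qed.

(** Every edge into the parent of t contributes to the second degree of t, with
the exception of the edge of t itself. *)
Lemma second_degree_ge G t : increasing G -> 0 < t <= size G -> parent G t != t ->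
  indeg G (parent G t) <= (second_degree G t).+1.
Proof.
move=> iG tG tr; rewrite /second_degree /indeg.
set P := (fun e : nat * nat => [&& _, _ & _]).
apply: (@leq_trans (count (predU P (fun e => e.1 == t)) G)).
  apply: sub_count => e /= /eqP e2; rewrite /P e2 tr /=.
  rewrite /Defs.adjacent [(t, parent G t) \in G]mem_edge// tG eqxx.
  by rewrite !orbT andbT orNb.
rewrite -addn1 -(leq_add2r (count (predI P (fun e => e.1 == t)) G)) count_predUI.
by rewrite -addnA leq_add2l count_fst// tG leq_addr.
Qed.

(** The neighbours of t are its parent and its children. An edge that avoids t
and touches the parent enters the parent or is its only outgoing edge; one
that touches a child enters the child, as the outgoing edge of a child ends
in t. *)
Lemma second_degree_le G t : increasing G -> 0 < t <= size G -> parent G t != t ->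
  second_degree G t <= (indeg G (parent G t) + grandkids G t).+1.
Proof.
move=> iG tG tr; rewrite /second_degree.
set A := fun e : nat * nat => e.2 == parent G t.
set B := fun e : nat * nat => is_child G t e.2.
set C := fun e : nat * nat => e.1 == parent G t.
apply: (@leq_trans (count (predU (predU A B) C) G)).
  set P := (X in count X G <= _).
  rewrite (@eq_in_count _ P (fun e => (e \in G) && P e)) => [|e ->]//.
  apply: sub_count => e /= /andP[eG /and3P[e1 e2]].
  rewrite /Defs.adjacent !mem_edge// tG /= /A /B /C /is_child (parent_mem iG eG).
  rewrite (negbTE e2) andbF /= [parent G t == e.1]eq_sym [parent G t == e.2]eq_sym.
  by case/or3P => [->|/andP[_ ->]|->]; rewrite ?orbT.
have c1 : count C G <= 1 by rewrite count_fst//; case: (_ < _ <= _).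
apply: (@leq_trans (count A G + count B G + count C G)); last by rewrite -addn1 leq_add2l.
have := count_predUI A B G; have := count_predUI (predU A B) C G; lia.
Qed.

Definition is_root (G : multigraph) t := parent G t == t.

Lemma count_sumb (T : Type) (P : pred T) (s : seq T) : count P s = \sum_(x <- s) P x.
Proof. by rewrite -sum1_count big_mkcond; apply: eq_bigr => x _; case: (P x). Qed.

(** Double counting of the vertices t according to their parents s. *)
Lemma sum_indeg_parent n k G : increasing G -> size G = n ->
  \sum_(s <- iota 1 n) indeg G s * (k <= indeg G s) =
  \sum_(t <- iota 1 n) (k <= indeg G (parent G t)).
Proof.
move=> iG Gn.
rewrite -Gn (big_vertices _ (fun _ p => nat_of_bool (k <= indeg G p)))//.
have := @sum_indeg nat G (size G) (fun s => (k <= indeg G s) : nat) iG (leqnn _).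
by apply: etrans; apply: eq_bigr => s _; rewrite natn.
Qed.

(** A vertex that is not a root has second degree at least k as soon as its
parent has indegree at least k + 1. *)
Lemma Y_ge n k G : increasing G -> size G = n ->
  \sum_(s <- iota 1 n) indeg G s * (k.+1 <= indeg G s) <=
  Y n k G + count (is_root G) (iota 1 n).
Proof.
move=> iG Gn; rewrite /Y !count_sumb sum_indeg_parent// -big_split/=.
rewrite big_seq [X in _ <= X]big_seq; apply: leq_sum => t.
rewrite mem_iota add1n ltnS -Gn => tG; rewrite /is_root.
have [_|tr] := eqVneq (parent G t) t; first by rewrite (leq_trans (leq_b1 _))// leq_addl.
have [kp|//] := leqP k.+1 (indeg G (parent G t)).
by have := leq_trans kp (second_degree_ge iG tG tr); rewrite ltnS => ->.
Qed.

(** If t is not a root and its parent has indegree D < k, then a second degree of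
at least k requires at least i = k - D - 1 grandchildren, by
[second_degree_le]. Either i is below the cutoff z, which gives a term of the
double sum, or t has at least z grandchildren. *)
Lemma Y_le n k z G : increasing G -> size G = n ->
  Y n k G <= count (is_root G) (iota 1 n)
    + \sum_(s <- iota 1 n) indeg G s * (k <= indeg G s)
    + \sum_(t <- iota 1 n) (~~ is_root G t && (z <= grandkids G t))
    + \sum_(i < z) \sum_(t <- iota 1 n)
        [&& ~~ is_root G t, indeg G (parent G t) + i.+1 == k & i <= grandkids G t].
Proof.
move=> iG Gn; rewrite /Y !count_sumb sum_indeg_parent// exchange_big/= -!big_split/=.
rewrite big_seq [X in _ <= X]big_seq; apply: leq_sum => t.
rewrite mem_iota add1n ltnS -Gn => tG; rewrite /is_root.
have [_|tr] := eqVneq (parent G t) t.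
  by rewrite (leq_trans (leq_b1 _))// -!addnA leq_addr.
have [kd|//] := leqP k (second_degree G t).
have := leq_trans kd (second_degree_le iG tG tr).
move: (indeg G _) (grandkids G t) => D Z kDZ.
have [//|kD] := leqP k D; have [//|Zz] := leqP z Z.
have kz : k - D.+1 < z by lia.
apply: leq_trans (leq_addl _ _); rewrite (bigD1 (Ordinal kz))//=.
have -> : D + (k - D.+1).+1 == k by apply/eqP; lia.
by have -> : k - D.+1 <= Z by lia.
Qed.
(** * Expectations along the growth of the graph *)

Local Open Scope ring_scope.

Section Expectation.
Variables (R : realType) (a : R).

Definition denom (n : nat) : R := (a + 1) * n.+1%:R - 1.

(** The unnormalised probability that the next edge goes to s. The new vertex
has indegree 0 before its edge is drawn, so that its weight a is covered by
the same formula. *)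
Definition rate (G : multigraph) (s : nat) : R := (indeg G s)%:R + a.

Lemma denomE n : denom n = (a + 1) * n%:R + a.
Proof. by rewrite /denom -natr1; ring. Qed.

Lemma BO_law_increasing n x : x \in BO_law a n ->
  increasing x.1 /\ size x.1 = n.
Proof.
elim: n x => [|[|n] IH] x; [by rewrite inE => /eqP->..|].
move=> /flattenP[l /mapP[y yn ->] /mapP[s]].
rewrite mem_iota => /andP[s1 sn] -> /=.
have /IH[iy sy] : y \in BO_law a n.+1 by [].
by rewrite sy iy eqxx s1 -ltnS sn.
Qed.

Lemma eq_BO_expect n (f g : multigraph -> R) :
  (forall G, increasing G -> size G = n -> f G = g G) ->
  BO_expect a n f = BO_expect a n g.
Proof.
move=> fg; rewrite /BO_expect big_seq [RHS]big_seq; apply: eq_bigr => x xn.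
by have [ix sx] := BO_law_increasing xn; rewrite fg.
Qed.

Lemma le_BO_expect (a0 : 0 < a) n (f g : multigraph -> R) :
  (forall G, increasing G -> size G = n -> f G <= g G) ->
  BO_expect a n f <= BO_expect a n g.
Proof.
move=> fg; rewrite /BO_expect big_seq [leRHS]big_seq; apply: ler_sum => x xn.
have [ix sx] := BO_law_increasing xn.
by rewrite ler_wpM2l ?fg// (BO_law_ge0 a0 xn).
Qed.

Lemma BO_expectD n (f g : multigraph -> R) :
  BO_expect a n (fun G => f G + g G) = BO_expect a n f + BO_expect a n g.
Proof. by rewrite /BO_expect -big_split/=; apply: eq_bigr => x _; rewrite mulrDr. Qed.

Lemma BO_expectZ n (f : multigraph -> R) r :
  BO_expect a n (fun G => r * f G) = r * BO_expect a n f.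
Proof. by rewrite /BO_expect mulr_sumr; apply: eq_bigr => x _; rewrite mulrCA. Qed.

Lemma BO_expect_sum n I (r : seq I) (P : pred I) (F : I -> multigraph -> R) :
  BO_expect a n (fun G => \sum_(i <- r | P i) F i G) =
  \sum_(i <- r | P i) BO_expect a n (F i).
Proof.
by rewrite /BO_expect exchange_big/=; apply: eq_bigr => x _; rewrite mulr_sumr.
Qed.

Lemma BO_expect_cst (a0 : 0 < a) n r : BO_expect a n (fun=> r) = r.
Proof. by rewrite /BO_expect -mulr_suml BO_law_sum1// mul1r. Qed.

Lemma BO_expect_ge0 (a0 : 0 < a) n (f : multigraph -> R) :
  (forall G, increasing G -> size G = n -> 0 <= f G) -> 0 <= BO_expect a n f.
Proof. by move=> f0; rewrite -(BO_expect_cst a0 n 0); exact: le_BO_expect. Qed.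

Lemma denom_gt0 (a0 : 0 < a) n : 0 < denom n.
Proof. exact: BO_denom_gt0. Qed.

Definition extend (G : multigraph) s : multigraph := ((size G).+1, s) :: G.

(** One step of the growth. This is valid from n = 0 on, because the first vertex
can only be attached to itself, with probability rate / denom = a / a. *)
Lemma BO_expectS (a0 : 0 < a) n (f : multigraph -> R) :
  BO_expect a n.+1 f = BO_expect a n (fun G =>
    (\sum_(s <- iota 1 n.+1) rate G s * f (extend G s)) / denom n).
Proof.
case: n => [|n].
  rewrite /BO_expect !big_seq1 /rate /extend /denom/= !mul1r.
  by rewrite mulr1 addrK add0r mulrAC divff ?mul1r// gt_eqF.
rewrite {1}/BO_expect -[BO_law a n.+2]/(BO_step a n.+2 (BO_law a n.+1)) /BO_step.
rewrite big_flatten big_map /BO_expect big_seq [RHS]big_seq; apply: eq_bigr => x xn.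
have [ix sx] := BO_law_increasing xn.
rewrite big_map mulr_suml mulr_sumr big_seq [RHS]big_seq; apply: eq_bigr => s.
rewrite mem_iota add1n ltnS => /andP[s1 sn] /=.
rewrite -mulrA /extend sx; congr (_ * _); rewrite mulrAC; congr (_ * _).
rewrite /attach_prob /rate /denom; case: eqP => [->|/eqP sn'].
  by rewrite indeg_default ?sx// add0r.
rewrite degree_indeg//; last by rewrite s1 sx -ltnS ltn_neqAle sn'.
by congr (_ / _); rewrite -natr1; ring.
Qed.

(** The total weight splits into the uniform choice of an edge, whose head is
copied, and a times the uniform choice of a vertex. *)
Lemma sum_rate G (w : nat -> R) n : increasing G -> size G = n ->
  \sum_(s <- iota 1 n.+1) rate G s * w s =
  \sum_(e <- G) w e.2 + a * \sum_(s <- iota 1 n.+1) w s.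
Proof.
move=> iG Gn; rewrite -(@sum_indeg _ _ n.+1 w)// ?Gn// mulr_sumr -big_split/=.
by apply: eq_bigr => s _; rewrite /rate mulrDl.
Qed.

Lemma sum_rate1 G n : increasing G -> size G = n ->
  \sum_(s <- iota 1 n.+1) rate G s = denom n.
Proof.
move=> iG Gn; under eq_bigr do rewrite -[rate _ _]mulr1.
rewrite (@sum_rate G (fun=> 1))// denomE !big_const_seq !count_predT size_iota Gn.
by rewrite !iter_addr_0 -natr1; ring.
Qed.

Lemma sum_pick (n s0 : nat) (F : nat -> R) : (0 < s0 <= n)%N ->
  \sum_(s <- iota 1 n) F s * (s == s0)%:R = F s0.
Proof.
move=> s0n; rewrite (bigD1_seq s0) ?iota_uniq//=; last by rewrite mem_iota add1n ltnS.
by rewrite eqxx mulr1 big1 ?addr0// => s /negbTE->; rewrite mulr0.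
Qed.

(** The indegrees of the children of t add up to the number of its
grandchildren. *)
Lemma sum_rate_child G n t : increasing G -> size G = n -> (0 < t)%N ->
  \sum_(s <- iota 1 n.+1) rate G s * (is_child G t s)%:R =
  (grandkids G t)%:R + a * (kids G t)%:R.
Proof.
move=> iG Gn t0; rewrite sum_rate// -(@count_children G t n.+1)// ?Gn//.
by rewrite /grandkids !count_sumb !natr_sum.
Qed.

(** The generator of the growth on functions of the indegree D of the parent of
t and of the numbers c and z of children and grandchildren of t. One step
changes at most one of them, by one: D with rate D + a, c with rate c + a (the
vertex t has indegree c), and z with rate z + a c. *)
Lemma sum_rate_stats (Phi : nat -> nat -> nat -> R) G n t : increasing G -> size G = n ->
  (0 < t <= n)%N -> parent G t != t ->
  let D := indeg G (parent G t) in let c := kids G t in let z := grandkids G t in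
  \sum_(s <- iota 1 n.+1) rate G s * Phi (indeg (extend G s) (parent (extend G s) t))
    (kids (extend G s) t) (grandkids (extend G s) t) =
  denom n * Phi D c z + (D%:R + a) * (Phi D.+1 c z - Phi D c z)
  + (c%:R + a) * (Phi D c.+1 z - Phi D c z)
  + (z%:R + a * c%:R) * (Phi D c z.+1 - Phi D c z).
Proof.
move=> iG Gn tn tr D c z.
have tG : (0 < t <= size G)%N by rewrite Gn.
have /andP[p0 pt] := parent_bounds iG tG.
have pn : (0 < parent G t <= n.+1)%N.
  by rewrite p0 (leq_trans pt)// leqW//; case/andP: tn.
have tn1 : (0 < t <= n.+1)%N by case/andP: tn => -> /leqW.
have cp : is_child G t (parent G t) = false.
  apply/negbTE; rewrite negb_and -implyNb negbK; apply/implyP => /eqP h; exfalso.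
  have pG : (0 < parent G t <= size G)%N.
    by rewrite p0 (leq_trans pt)//; case/andP: tG.
  have /andP[_] := parent_bounds iG pG; rewrite h => tp.
  by move: tr; rewrite eqn_leq pt tp.
have ct : is_child G t t = false by rewrite /is_child eqxx andbF.
transitivity (\sum_(s <- iota 1 n.+1) (rate G s * Phi D c z
   + rate G s * (s == parent G t)%:R * (Phi D.+1 c z - Phi D c z)
   + rate G s * (s == t)%:R * (Phi D c.+1 z - Phi D c z)
   + rate G s * (is_child G t s)%:R * (Phi D c z.+1 - Phi D c z))).
  rewrite big_seq [RHS]big_seq; apply: eq_bigr => s.
  rewrite mem_iota add1n ltnS => /andP[s1 sn].
  rewrite /extend parent_cons; last by case/andP: tG.
  rewrite indeg_cons kids_cons; last by case/andP: tG.
  rewrite grandkids_cons//; last by rewrite s1 Gn.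
  rewrite -/D -/c -/z /=.
  have [->|sp] := eqVneq s (parent G t).
    by rewrite cp (negbTE tr) /= add1n !add0n; ring.
  have [->|st] := eqVneq s t; first by rewrite ct /= add1n !add0n; ring.
  by case: is_child; rewrite /= ?add1n !add0n; ring.
rewrite !big_split -!mulr_suml sum_rate1// !sum_pick// sum_rate_child//; last by case/andP: tn.
by rewrite /rate -/D (indeg_kids iG tG tr) -/c -/z.
Qed.

Lemma sum_rate_indeg (w : nat -> R) G n : increasing G -> size G = n ->
  \sum_(s <- iota 1 n.+1) rate G s * \sum_(v <- iota 1 n.+1) w (indeg (extend G s) v) =
  \sum_(v <- iota 1 n.+1) (denom n * w (indeg G v) +
     rate G v * (w (indeg G v).+1 - w (indeg G v))).
Proof.
move=> iG Gn; under eq_bigr do rewrite mulr_sumr.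
rewrite exchange_big big_seq [RHS]big_seq; apply: eq_bigr => v.
rewrite mem_iota add1n ltnS => vn.
transitivity (\sum_(s <- iota 1 n.+1) (rate G s * w (indeg G v) +
   rate G s * (s == v)%:R * (w (indeg G v).+1 - w (indeg G v)))).
  apply: eq_bigr => s _; rewrite indeg_cons/=.
  by case: eqP => _; rewrite /= ?add1n ?add0n; ring.
by rewrite big_split -!mulr_suml sum_rate1// sum_pick.
Qed.

End Expectation.

(** * Expected numbers of vertices of given indegree *)

Section DegreeCounts.
Variables (R : realType) (a : R).

(** The sum includes the vertex n + 1, which is about to be born and has
indegree 0. This makes the recurrence [expdegS] the same at all times. *)
Definition expdeg (n i : nat) : R :=
  BO_expect a n (fun G => \sum_(v <- iota 1 n.+1) (indeg G v == i)%:R).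

(** In each step a vertex of indegree i moves up with probability
(i + a) / denom, and one vertex is added to the class of indegree 0. *)
Lemma expdegS (a0 : 0 < a) n i :
  expdeg n.+1 i = (i == 0)%:R + (1 - (i%:R + a) / denom a n) * expdeg n i
    + (if i is j.+1 then (j%:R + a) / denom a n * expdeg n j else 0).
Proof.
have T0 : denom a n != 0 by rewrite gt_eqF// denom_gt0.
pose w := fun d => (d == i)%:R : R.
pose w' := fun d => if i is j.+1 then (j%:R + a) * (d == j)%:R else 0 : R.
transitivity (BO_expect a n (fun G => w 0%N + ((1 - (i%:R + a) / denom a n) *
   \sum_(v <- iota 1 n.+1) w (indeg G v)
   + (denom a n)^-1 * \sum_(v <- iota 1 n.+1) w' (indeg G v)))).
  rewrite /expdeg BO_expectS//; apply: eq_BO_expect => G iG Gn.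
  transitivity ((\sum_(s <- iota 1 n.+1) (rate a G s * w 0%N +
     rate a G s * \sum_(v <- iota 1 n.+1) w (indeg (extend G s) v))) / denom a n).
    congr (_ / _); rewrite big_seq [RHS]big_seq; apply: eq_bigr => s.
    rewrite mem_iota add1n ltnS => /andP[s1 sn].
    rewrite iota1S big_rcons/= mulrDr addrC; congr (_ * _ + _).
    by rewrite indeg_default ?Gn// addn0 [s == _]ltn_eqF.
  rewrite big_split -mulr_suml sum_rate1// sum_rate_indeg// mulrDl mulrAC divff// mul1r.
  congr (_ + _); rewrite !mulr_sumr -big_split mulr_suml; apply: eq_bigr => v _.
  rewrite /rate /w /w'; move: (indeg G v) => d /=.
  have -> : (d%:R + a) * ((d.+1 == i)%:R - (d == i)%:R) =
     (if i is j.+1 then (j%:R + a) * (d == j)%:R else 0) - (i%:R + a) * (d == i)%:R :> R.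
    rewrite mulrBr; congr (_ - _); last by case: eqP => [->//|_]; rewrite !mulr0.
    by case: (i) => [|j]; rewrite ?mulr0// eqSS; case: eqP => [->//|_]; rewrite !mulr0.
  by case: (i) => [|j]; field.
rewrite BO_expectD BO_expect_cst// BO_expectD !BO_expectZ -addrA.
congr (_ + (_ + _)); first by rewrite /w eq_sym.
rewrite /w'; case: i {w w'} => [|j].
  under eq_BO_expect => G _ _ do rewrite big1//.
  by rewrite BO_expect_cst// mulr0.
under eq_BO_expect => G _ _ do rewrite -mulr_sumr.
by rewrite BO_expectZ mulrA [_^-1 * _]mulrC.
Qed.

Lemma expdeg_ge0 (a0 : 0 < a) n i : 0 <= expdeg n i.
Proof. by apply: BO_expect_ge0 => // G _ _; apply: sumr_ge0 => v _. Qed.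

Lemma expdeg_le_size (a0 : 0 < a) n i : expdeg n i <= n.+1%:R.
Proof.
rewrite -[leRHS](@BO_expect_cst _ a a0 n); apply: le_BO_expect => // G _ _.
rewrite -natr_sum ler_nat -count_sumb.
by rewrite (leq_trans (count_size _ _))// size_iota.
Qed.

Lemma expdeg_default (a0 : 0 < a) n i : (n < i)%N -> expdeg n i = 0.
Proof.
move=> ni; rewrite -[RHS](@BO_expect_cst _ a a0 n).
apply: eq_BO_expect => G _ Gn; rewrite big1// => v _.
by rewrite ltn_eqF// (leq_ltn_trans (indeg_le_size G v))// Gn.
Qed.

(** By [sum_indeg_parent] this is also the expected number of vertices whose
parent has indegree at least k. *)
Definition exptail (n k : nat) : R :=
  BO_expect a n (fun G => (\sum_(s <- iota 1 n) indeg G s * (k <= indeg G s))%N%:R).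

(** The indegrees of n vertices add up to n. *)
Lemma exptailE (a0 : 0 < a) n k : exptail n k = n%:R - \sum_(i < k) i%:R * expdeg n i.
Proof.
apply/eqP; rewrite eq_sym subr_eq eq_sym; apply/eqP.
under eq_bigr do rewrite /expdeg -BO_expectZ.
rewrite -BO_expect_sum -BO_expectD -[RHS](@BO_expect_cst _ a a0 n).
apply: eq_BO_expect => G iG Gn.
transitivity (\sum_(v <- iota 1 n.+1) (indeg G v)%:R : R); last first.
  under eq_bigr do rewrite -[_%:R]mulr1.
  by rewrite (@sum_indeg R G n.+1 (fun=> 1))// ?Gn// -Gn big_const_seq count_predT iter_addr_0.
under [X in _ + X]eq_bigr do rewrite mulr_sumr.
rewrite exchange_big natr_sum.
have -> : \sum_(v <- iota 1 n) (indeg G v * (k <= indeg G v))%:R =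
    \sum_(v <- iota 1 n.+1) (indeg G v * (k <= indeg G v))%:R :> R.
  by rewrite [in RHS]iota1S big_rcons/= indeg_default ?Gn// mul0n addr0.
rewrite -big_split; apply: eq_bigr => v _; move: (indeg G v) => d /=.
have [kd|dk] := leqP k d.
  rewrite muln1 big1 ?addr0// => i _; rewrite gtn_eqF ?mulr0//.
  exact: leq_trans (ltn_ord i) kd.
rewrite muln0 add0r (bigD1 (Ordinal dk))//= eqxx mulr1 big1 ?addr0// => i.
rewrite -val_eqE/= eq_sym => /negbTE->; exact: mulr0.
Qed.

Lemma limdeg_decr (a0 : 0 < a) i j : (i <= j)%N -> limdeg a j <= limdeg a i.
Proof.
move=> /subnK <-; elim: (j - i)%N => [|m IH] //.
apply: le_trans IH; rewrite addSn limdegS ger_pMl ?(limdeg_gt0 a0)//.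
by rewrite ler_pdivrMr; [rewrite -natr1; lra|rewrite -addrA nat_shift_gt0//; lra].
Qed.

(** The shift for which limdeg i * (n + time_shift) solves the recurrence
[expdegS] exactly. It is locked so that [ring] and [field] treat it as an atom. *)
Definition time_shift : R := locked (a / (a + 1)).

Lemma time_shiftE : time_shift = a / (a + 1).
Proof. by rewrite /time_shift -lock. Qed.

Lemma time_shift_gt0 (a0 : 0 < a) : 0 < time_shift.
Proof. by rewrite time_shiftE divr_gt0//; lra. Qed.

Lemma time_shift_le1 (a0 : 0 < a) : time_shift <= 1.
Proof. by rewrite time_shiftE ler_pdivrMr; lra. Qed.

Lemma denom_shift (a0 : 0 < a) n : denom a n = (a + 1) * (n%:R + time_shift).
Proof. by rewrite denomE mulrDr time_shiftE mulrCA divff ?mulr1// gt_eqF//; lra. Qed.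

Lemma limdeg_balance (a0 : 0 < a) n i :
  limdeg a i * (n.+1%:R + time_shift) = (i == 0)%:R
    + (1 - (i%:R + a) / denom a n) * (limdeg a i * (n%:R + time_shift))
    + (if i is j.+1 then (j%:R + a) / denom a n * (limdeg a j * (n%:R + time_shift)) else 0).
Proof.
have b0 := time_shift_gt0 a0.
have nb : n%:R + time_shift != 0 by rewrite gt_eqF// nat_shift_gt0.
have a1 : a + 1 != 0 by rewrite gt_eqF//; lra.
have e (x y : R) : x / denom a n * (y * (n%:R + time_shift)) = x * y / (a + 1).
  by rewrite denom_shift//; field; rewrite nb a1.
rewrite mulrBl mul1r e -natr1; case: i => [|j].
  by rewrite /limdeg/=; field; rewrite a1 gt_eqF//; lra.
rewrite e; have := limparS a0 j; rewrite /limpar => h.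
rewrite -h add0r; field.
by rewrite a1.
Qed.

(** From the time n0 on, the coefficients of the recurrence [expdegS] are
nonnegative for all indegrees that occur. *)
Lemma rate_le_denomS (n0 n i : nat) : 0 < a -> 1 <= a * n0%:R -> (n0 <= n)%N ->
  (i <= n.+1)%N -> i%:R + a <= denom a n.
Proof.
move=> a0 an0 n0n; rewrite -(@ler_nat R) -natr1 denomE => h.
move: n0n; rewrite -(@ler_nat R) => h2; nra.
Qed.

(** Comparison with the exact solution. The constant K makes the claim true at
time n0 and absorbs the vertices that are born; afterwards the recurrence has
nonnegative coefficients and preserves the inequality. *)
Lemma expdeg_le (a0 : 0 < a) (n0 : nat) : 1 <= a * n0%:R ->
  exists2 K : R, 0 < K & forall n i, (n0 <= n)%N ->
    expdeg n i <= K * limdeg a i * (n%:R + time_shift).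
Proof.
move=> an0; have b0 := time_shift_gt0 a0.
have [K K0 KE] : exists2 K, 0 < K & K * limdeg a n0 * time_shift = n0.+1%:R.
  have d0 : 0 < limdeg a n0 * time_shift := mulr_gt0 (limdeg_gt0 a0 n0) b0.
  exists (n0.+1%:R / (limdeg a n0 * time_shift)); first by rewrite divr_gt0 ?ltr0n.
  by rewrite -mulrA divfK// gt_eqF.
exists K => //.
move=> n i /subnK <-; elim: (n - n0)%N i => [|m IH] i.
  rewrite add0n; have [n0i|in0] := ltnP n0 i.
    rewrite expdeg_default// ltW// mulr_gt0 ?nat_shift_gt0//.
    by rewrite mulr_gt0 ?(limdeg_gt0 a0).
  apply: (le_trans (expdeg_le_size a0 n0 i)).
  rewrite -KE.
  have d0 := limdeg_gt0 a0 n0.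
  apply: ler_pM; rewrite ?mulr_ge0 ?(ltW K0) ?(ltW b0) ?(ltW d0)// ?lerDr//.
  by rewrite ler_pM2l// limdeg_decr.
rewrite addSn; set n' := (m + n0)%N in IH *.
have n0n' : (n0 <= n')%N by rewrite leq_addl.
have pos j : 0 < K * limdeg a j * (n'.+1%:R + time_shift).
  by rewrite !mulr_gt0 ?(limdeg_gt0 a0) ?nat_shift_gt0.
have [ni|ni] := ltnP n'.+1 i; first by rewrite expdeg_default// ltW.
rewrite expdegS// -mulrA limdeg_balance// [K * _]mulrDr [K * (_ + _ * _)]mulrDr.
have D0 := denom_gt0 a0 n'.
have c1 : 0 <= 1 - (i%:R + a) / denom a n'.
  by rewrite subr_ge0 ler_pdivrMr// mul1r (rate_le_denomS a0 an0).
rewrite lerD//.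
  apply: lerD; last by rewrite mulrCA ler_wpM2l// mulrA.
  case: eqP => _; rewrite ?mulr0// mulr1.
  have d1 : limdeg a 0 <= 1 by rewrite /limdeg ler_pdivrMr; lra.
  have d2 := le_trans (limdeg_decr a0 (leq0n n0)) d1.
  have /le_trans : 1 <= K * limdeg a n0 * time_shift by rewrite KE ler1n.
  apply; rewrite -mulrA ler_piMr ?(ltW K0)//.
  by rewrite mulr_ile1 ?(ltW b0) ?time_shift_le1 ?(ltW (limdeg_gt0 a0 _)).
case: (i) => [|j]; first by rewrite mulr0.
by rewrite mulrCA ler_wpM2l ?mulrA// divr_ge0 ?(ltW D0)// addr_ge0 ?(ltW a0).
Qed.

(** The difference e of the expected counts and of the exact solution satisfies
the recurrence without its source term. In terms of the products
(i + a) * e i the recurrence forms convex combinations, since the weights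
1 - (j + 1 + a) / denom and (j + 1 + a) / denom add up to 1, so the bound at
time n0 persists. *)
Lemma expdeg_err (a0 : 0 < a) (n0 : nat) : 1 <= a * n0%:R ->
  exists2 C : R, 0 < C & forall n i, (n0 <= n)%N ->
    (i%:R + a) * `|expdeg n i - limdeg a i * (n%:R + time_shift)| <= C.
Proof.
move=> an0; have b0 := time_shift_gt0 a0.
have b1 := time_shift_le1 a0.
pose C := (n0%:R + a) * n0.+1%:R + a * (n0%:R + 2).
have C0 : 0 < C.
  by apply: addr_gt0; apply: mulr_gt0; rewrite ?ltr0n ?nat_shift_gt0.
exists C => // n i /subnK <-; elim: (n - n0)%N i => [|m IH] i.
  rewrite add0n -[X in X * `|_|]ger0_norm ?addr_ge0 ?(ltW a0)// -normrM mulrBr.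
  apply: (le_trans (ler_normB _ _)); apply: lerD.
    rewrite ger0_norm ?mulr_ge0 ?addr_ge0 ?expdeg_ge0 ?(ltW a0)//.
    have [n0i|in0] := ltnP n0 i.
      by rewrite expdeg_default// mulr0 mulr_ge0// addr_ge0 ?(ltW a0).
    by rewrite ler_pM ?addr_ge0 ?expdeg_ge0 ?(ltW a0) ?expdeg_le_size// lerD2r ler_nat.
  rewrite mulrA -limparS// ger0_norm; last first.
    by rewrite mulr_ge0 ?addr_ge0 ?(ltW b0) ?(ltW (limpar_gt0 a0 _)).
  apply: ler_pM; rewrite ?addr_ge0 ?(ltW b0) ?(ltW (limpar_gt0 a0 _))//; last by lra.
  have := limpar_le_inv a0 0; rewrite mul1r => h1.
  by apply: le_trans (limpar_homo a0 _) h1.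
rewrite addSn; set n' := (m + n0)%N in IH *.
have n0n' : (n0 <= n')%N by rewrite leq_addl.
have D0 := denom_gt0 a0 n'.
have [ni|ni] := ltnP n'.+1 i.
  rewrite expdeg_default// sub0r normrN ger0_norm; last first.
    by rewrite mulr_ge0 ?addr_ge0 ?(ltW b0) ?(ltW (limdeg_gt0 a0 _)).
  rewrite mulrA -limparS//; apply: (@le_trans _ _ (i.+1%:R * limpar a i.+1)).
    rewrite mulrC ler_wpM2r ?(ltW (limpar_gt0 a0 _))//.
    have : n'.+2%:R <= i%:R :> R by rewrite ler_nat.
    by rewrite -[n'.+2%:R]natr1 -[i.+1%:R]natr1; lra.
  apply: (le_trans (limpar_le_inv a0 i)); rewrite /C.
  have : 0 <= n0%:R :> R by []; have : 1 <= n0.+1%:R :> R by rewrite ler1n.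
  nra.
have c1 : 0 <= 1 - (i%:R + a) / denom a n'.
  by rewrite subr_ge0 ler_pdivrMr// mul1r (rate_le_denomS a0 an0).
rewrite expdegS// limdeg_balance//.
have ia : 0 < i%:R + a by rewrite nat_shift_gt0.
pose e j := expdeg n' j - limdeg a j * (n'%:R + time_shift).
have he j : (j%:R + a) * `|e j| <= C by exact: IH.
case: i ni c1 ia => [|j] ni c1 ia.
  rewrite (_ : _ - _ = (1 - (0%:R + a) / denom a n') * e 0%N); last by rewrite /e; ring.
  rewrite normrM (ger0_norm c1) mulrCA (le_trans _ (he 0%N))// ler_piMl ?mulr_ge0 ?(ltW ia)//.
  by rewrite lerBlDr lerDl divr_ge0 ?(ltW ia) ?(ltW D0).
rewrite (_ : _ - _ = (1 - (j.+1%:R + a) / denom a n') * e j.+1 + (j%:R + a) / denom a n' * e j);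
  last by rewrite /e; ring.
have ja : 0 < j%:R + a by rewrite nat_shift_gt0.
have q0 : 0 <= (j.+1%:R + a) / denom a n' by rewrite divr_ge0 ?(ltW ia) ?(ltW D0).
apply: (@le_trans _ _ ((1 - (j.+1%:R + a) / denom a n') * ((j.+1%:R + a) * `|e j.+1|)
   + (j.+1%:R + a) / denom a n' * ((j%:R + a) * `|e j|))).
  apply: (@le_trans _ _ ((j.+1%:R + a) * (`|(1 - (j.+1%:R + a) / denom a n') * e j.+1|
     + `|(j%:R + a) / denom a n' * e j|))).
    by rewrite ler_wpM2l ?(ltW ia)// ler_normD.
  rewrite !normrM (ger0_norm c1) (gtr0_norm ja) normfV (gtr0_norm D0).
  by rewrite le_eqVlt; apply/orP; left; apply/eqP; ring.
apply: (@le_trans _ _ ((1 - (j.+1%:R + a) / denom a n') * C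
   + (j.+1%:R + a) / denom a n' * C)); last by rewrite -mulrDl subrK mul1r.
by apply: lerD; rewrite ler_wpM2l.
Qed.

Lemma archi_threshold (a0 : 0 < a) : exists2 n0 : nat, (0 < n0)%N & 1 <= a * n0%:R.
Proof.
exists (Num.bound a^-1).+1 => //.
rewrite -ler_pdivrMl// mulr1 (le_trans (ltW (archi_boundP _)))// ?invr_ge0 ?(ltW a0)//.
by rewrite ler_nat.
Qed.

Lemma limtail_step (a0 : 0 < a) k : limtail a k.+2 = limtail a k.+1 - k.+1%:R * limdeg a k.+1.
Proof.
have := sum_limdeg a0 k.+1; rewrite big_ord_recr/= sum_limdeg// => h.
by apply/eqP; rewrite eq_sym -subr_eq0; apply/eqP; move: h; set x := _ * limdeg _ _; lra.
Qed.

Lemma limtail_bounds (a0 : 0 < a) k : 0 <= limtail a k.+1 <= 1.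
Proof.
apply/andP; split; last first.
  have := sum_limdeg a0 k; have : 0 <= \sum_(i < k.+1) i%:R * limdeg a i.
    by apply: sumr_ge0 => i _; rewrite mulr_ge0 ?(ltW (limdeg_gt0 a0 _)).
  lra.
rewrite /limtail mulr_ge0 ?invr_ge0 ?(ltW a0)// mulr_ge0 ?(ltW (limpar_gt0 a0 _))//.
by rewrite addr_ge0// divr_ge0; lra.
Qed.

Lemma exptail_bounds (a0 : 0 < a) n k : 0 <= exptail n k <= n%:R.
Proof.
apply/andP; split; first exact: BO_expect_ge0.
rewrite exptailE// lerBlDr lerDl; apply: sumr_ge0 => i _.
by rewrite mulr_ge0 ?expdeg_ge0.
Qed.

(** By [exptailE] the tail is n minus a sum of k terms i * expdeg n i, each of
which is known up to O(1) by [expdeg_err]. *)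
Lemma exptail_asymp (a0 : 0 < a) : exists2 C : R, 0 < C & forall n k, (0 < k)%N ->
  `|exptail n k - n%:R * limtail a k| <= C * k%:R.
Proof.
have [n0 n00 an0] := archi_threshold a0; have b0 := time_shift_gt0 a0.
have [C C0 hC] := expdeg_err a0 an0.
exists (C + time_shift * a + n0%:R) => [|n [//|k] _].
  by rewrite !addr_gt0 ?mulr_gt0 ?ltr0n.
have k1 : 1 <= k.+1%:R :> R by rewrite ler1n.
have [nn0|n0n] := ltnP n n0.
  apply: (@le_trans _ _ n0%:R); last first.
    rewrite -[leLHS]mulr1; apply: ler_pM => //; rewrite lerDr.
    by rewrite addr_ge0 ?mulr_ge0 ?ltW.
  have /andP[e0 e1] := exptail_bounds a0 n k.+1.
  have /andP[p0 p1] := limtail_bounds a0 k.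
  have : n%:R <= n0%:R :> R by rewrite ler_nat ltnW.
  have : 0 <= n%:R * limtail a k.+1 by rewrite mulr_ge0.
  have : n%:R * limtail a k.+1 <= n%:R by rewrite ler_piMr.
  by rewrite ler_norml => *; apply/andP; split; lra.
rewrite exptailE//.
have -> : limtail a k.+1 = 1 - \sum_(i < k.+1) i%:R * limdeg a i by rewrite sum_limdeg//; ring.
rewrite mulrBr mulr1 mulr_sumr opprB addrC addrA subrK -sumrB.
apply: (le_trans (ler_norm_sum _ _ _)).
rewrite mulr_natr -[in leRHS](card_ord k.+1) -sumr_const; apply: ler_sum => i _.
have ia : i%:R <= i%:R + a by lra.
rewrite (_ : _ - _ = - (i%:R * (expdeg n i - limdeg a i * (n%:R + time_shift)))
  - time_shift * (i%:R * limdeg a i)); last by ring.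
apply: (le_trans (ler_normB _ _)); rewrite normrN -[leRHS]addrA.
apply: lerD.
  apply: le_trans (hC n i n0n); rewrite normrM ger0_norm//.
  by rewrite ler_wpM2r.
apply: (@le_trans _ _ (time_shift * a)); last by rewrite lerDl.
have ci := limdeg_gt0 a0 i.
rewrite ger0_norm ?mulr_ge0 ?(ltW b0) ?(ltW ci)// ler_wpM2l ?(ltW b0)//.
apply: (@le_trans _ _ (limpar a i.+1)); first by rewrite limparS// ler_wpM2r ?(ltW ci).
have := limpar_le_inv a0 0; rewrite mul1r; apply: le_trans.
exact: limpar_homo.
Qed.

End DegreeCounts.

(** * A Lyapunov potential for grandchildren *)

Section Rising.
Variable R : realFieldType.

(** Rising factorials rather than powers are used for the moments, because
their unit increments have no terms of lower order: [rising_jump] is an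
equality at d = 1. *)
Definition rising (p : nat) (v : R) : R := \prod_(i < p) (v + i%:R).

Lemma rising0 v : rising 0 v = 1.
Proof. exact: big_ord0. Qed.

Lemma risingS p v : rising p.+1 v = v * rising p (v + 1).
Proof.
rewrite /rising big_ord_recl addr0; congr (_ * _); apply: eq_bigr => i _.
by rewrite lift0 -natr1; ring.
Qed.

Lemma risingSr p v : rising p.+1 v = rising p v * (v + p%:R).
Proof. by rewrite /rising big_ord_recr. Qed.

Lemma rising_ge0 p v : 0 <= v -> 0 <= rising p v.
Proof. by move=> v0; apply: prodr_ge0 => i _; rewrite addr_ge0. Qed.

Lemma rising_homo p v w : 0 <= v -> v <= w -> rising p v <= rising p w.
Proof.
move=> v0 vw; apply: ler_prod => i _.
by rewrite addr_ge0//= lerD2r.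
Qed.

Lemma expr_le_rising p v : 0 <= v -> v ^+ p <= rising p v.
Proof.
move=> v0; elim: p => [|p IH]; first by rewrite rising0.
by rewrite exprSr risingSr ler_pM ?exprn_ge0// lerDl.
Qed.

(** The left-hand side is convex in d, the right-hand side is affine, and they
agree at d = 0 and d = 1. *)
Lemma rising_jump p v d : 0 <= v -> 0 <= d <= 1 ->
  rising p.+1 (v + d) <= rising p.+1 v + d * p.+1%:R * rising p (v + 1).
Proof.
move=> v0 /andP[d0 d1]; elim: p => [|p IH].
  by rewrite !risingS !rising0; lra.
rewrite [leLHS]risingSr.
apply: (le_trans (ler_wpM2r _ IH)); first by rewrite !addr_ge0.
rewrite risingS risingS [rising p.+1 (v + 1)]risingSr.
rewrite -[p.+2%:R]natr1 -[p.+1%:R]natr1.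
have := rising_ge0 p (addr_ge0 v0 (@ler01 R)); have := ler0n R p.
move: (rising p (v + 1)) (p%:R) => s q q0 s0.
rewrite -subr_ge0 (_ : _ - _ = s * d * (q + 1) * (1 - d)); last by ring.
have d1d : 0 <= 1 - d by rewrite subr_ge0.
by rewrite mulr_ge0// mulr_ge0 ?addr_ge0// mulr_ge0.
Qed.

Lemma rising_gain p v d : 0 <= v -> 0 <= d ->
  rising p.+1 v + d * rising p (v + 1) <= rising p.+1 (v + d).
Proof.
move=> v0 d0; rewrite !risingS -mulrDl ler_wpM2l ?addr_ge0//.
by rewrite rising_homo ?addr_ge0// lerD2r lerDl.
Qed.
End Rising.

Section Lyapunov.
Variables (R : realType) (a : R).

(** A child weighs theta because it will bring grandchildren later on; L scales
theta to at most 1, as [rising_jump] requires. *)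
Definition potential (theta L : R) (c z : nat) : R :=
  (z%:R + theta * (c%:R + a)) / L.

Lemma potential_ge0 (a0 : 0 < a) theta L c z : 0 <= theta -> 0 < L ->
  0 <= potential theta L c z.
Proof.
move=> th0 L0; rewrite /potential divr_ge0 ?(ltW L0)// addr_ge0// mulr_ge0// addr_ge0//.
exact: ltW.
Qed.

(** The left-hand side is the generator of [sum_rate_stats] applied to a weight
of D times a moment of the potential, with T for the denominator, lam for
D + a, and h and h1 for the weights at D and D + 1. By [rising_jump] the
drift of the moment is at most p * rising (p - 1) (V + 1) times the drift of
the potential V. The latter is V + a c / L: the first part multiplies the
moment by p, and the second is compensated by an increase of theta by
p (2 a + 1) / T. The factor 2 a + 1 is what the hypothesis on lam permits,
as it gives a T <= (2 a + 1) (T - lam). *)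
Lemma lyapunov_step (a0 : 0 < a) (p : nat) (T lam theta L h h1 : R) (c z : nat) :
  let phi th c z := rising p (potential th L c z) in
  0 < T -> 0 <= lam -> (2 * a + 1) * lam <= (a + 1) * T ->
  1 <= L -> 0 <= theta <= L -> 0 <= h -> 0 <= h1 ->
  T * (h * phi theta c z) + lam * (h1 * phi theta c z - h * phi theta c z)
  + (c%:R + a) * (h * phi theta c.+1 z - h * phi theta c z)
  + (z%:R + a * c%:R) * (h * phi theta c z.+1 - h * phi theta c z) <=
  (h * (T + p%:R) + lam * (h1 - h)) *
    phi (theta + p%:R * (2 * a + 1) / T) c z.
Proof.
move=> phi T0 lam0 lamT L1 /andP[th0 thL] h0 h10.
have L0 : 0 < L by lra.
case: p @phi => [|q] phi.
  by rewrite /phi !rising0 le_eqVlt; apply/orP; left; apply/eqP; ring.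
set V := potential theta L c z.
have V0 : 0 <= V by exact: potential_ge0.
set s := rising q (V + 1).
have s0 : 0 <= s by rewrite rising_ge0// addr_ge0.
have phiE : phi theta c z = V * s by rewrite /phi risingS.
have jc : phi theta c.+1 z <= V * s + theta / L * q.+1%:R * s.
  rewrite -phiE /phi (_ : potential theta L c.+1 z = V + theta / L).
    by apply: rising_jump; rewrite // divr_ge0 ?(ltW L0)//= ler_pdivrMr// mul1r.
  by rewrite /V /potential -natr1; field; rewrite gt_eqF.
have jz : phi theta c z.+1 <= V * s + L^-1 * q.+1%:R * s.
  rewrite -phiE /phi (_ : potential theta L c z.+1 = V + L^-1).
    by apply: rising_jump; rewrite // invr_ge0 ?(ltW L0)//= invf_le1.
  by rewrite /V /potential -natr1; field; rewrite gt_eqF.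
set p := q.+1%:R in jc jz *; have p0 : 0 <= p by rewrite /p.
set eps := p * (2 * a + 1) / T * (c%:R + a) / L.
have ca0 : 0 <= c%:R + a by rewrite addr_ge0// ltW.
have eps0 : 0 <= eps by rewrite /eps !mulr_ge0 ?invr_ge0 ?(ltW T0) ?(ltW L0)//; lra.
have gain : V * s + eps * s <= phi (theta + p * (2 * a + 1) / T) c z.
  rewrite -phiE /phi (_ : potential (theta + _) L c z = V + eps); first exact: rising_gain.
  by rewrite /V /eps /potential; field; rewrite !gt_eqF.
rewrite phiE.
have lamT' : lam <= T by nra.
have co0 : 0 <= h * (T + p) + lam * (h1 - h).
  have : 0 <= h * (T - lam) by rewrite mulr_ge0// subr_ge0.
  have : 0 <= h * p by rewrite mulr_ge0.
  have : 0 <= lam * h1 by rewrite mulr_ge0.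
  lra.
apply: le_trans (ler_wpM2l co0 gain).
have zc0 : 0 <= z%:R + a * c%:R by rewrite addr_ge0// mulr_ge0// ltW.
have b1 : (c%:R + a) * (h * phi theta c.+1 z - h * (V * s)) <=
    (c%:R + a) * h * (theta / L * p * s).
  by have := ler_wpM2l (mulr_ge0 ca0 h0) jc; move: (phi _ _ _) => x; lra.
have b2 : (z%:R + a * c%:R) * (h * phi theta c z.+1 - h * (V * s)) <=
    (z%:R + a * c%:R) * h * (L^-1 * p * s).
  by have := ler_wpM2l (mulr_ge0 zc0 h0) jz; move: (phi _ _ _) => x; lra.
have b12 : (c%:R + a) * h * (theta / L * p * s) + (z%:R + a * c%:R) * h * (L^-1 * p * s)
    = h * p * s * V + h * s * (p * (a * c%:R) / L).
  by rewrite /V /potential; field; rewrite gt_eqF.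
have b3 : p * (a * c%:R) / L <= eps * (T - lam).
  rewrite /eps (_ : _ * (T - lam) =
      p * ((c%:R + a) * ((2 * a + 1) * (T - lam) / T)) / L); last by ring.
  rewrite ler_wpM2r ?invr_ge0 ?(ltW L0)// ler_wpM2l// mulrC.
  have aT : a <= (2 * a + 1) * (T - lam) / T by rewrite ler_pdivlMr//; lra.
  have c0 : 0 <= c%:R :> R by [].
  apply: ler_pM => //; [exact: ltW|lra].
have b4 := ler_wpM2l (mulr_ge0 h0 s0) b3.
have b5 : 0 <= eps * s * (h * p + lam * h1).
  exact: mulr_ge0 (mulr_ge0 eps0 s0) (addr_ge0 (mulr_ge0 h0 p0) (mulr_ge0 lam0 h10)).
move: b1 b2 b12 b4 b5; clear -R; clearbody p s eps V; move: (phi theta c.+1 z) (phi theta c z.+1) => x y.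
lra.
Qed.

Definition nonroot (G : multigraph) (t : nat) : R := (~~ is_root G t)%:R.

(** The weight h makes it possible to restrict the expectation to a fixed value
of the indegree of the parent of t. *)
Definition exp_potential (t p : nat) (theta L : R) (h : nat -> R) (n : nat) : R :=
  BO_expect a n (fun G => nonroot G t *
    (h (indeg G (parent G t)) * rising p (potential theta L (kids G t) (grandkids G t)))).

(** [lyapunov_step] averaged over the graph at time n: one step back in time the
children weigh more and the weight h is replaced by its expected value after
the step, with p added to the total rate. *)
Lemma exp_potentialS (a0 : 0 < a) (t p n : nat) (theta L : R) (h : nat -> R) :
  (0 < t <= n)%N -> 1 <= L -> 0 <= theta <= L -> (forall d, 0 <= h d) ->
  exp_potential t p theta L h n.+1 <=
  exp_potential t p (theta + p%:R * (2 * a + 1) / denom a n) L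
    (fun d => (h d * (denom a n + p%:R) + (d%:R + a) * (h d.+1 - h d)) / denom a n) n.
Proof.
move=> tn L1 thL h0; have T0 := denom_gt0 a0 n.
rewrite /exp_potential BO_expectS//; apply: le_BO_expect => // G iG Gn.
have tG : (t <= size G)%N by rewrite Gn; case/andP: tn.
rewrite /nonroot.
have rootE s : is_root (extend G s) t = is_root G t by rewrite /is_root parent_cons.
under eq_bigr do rewrite rootE mulrCA.
rewrite -mulr_sumr -mulrA; case: (boolP (is_root G t)) => [_|tr]; first by rewrite !mul0r.
rewrite !mul1r mulrAC ler_pM2r ?invr_gt0//.
have := @sum_rate_stats R a (fun d c z => h d * rising p (potential theta L c z)) G n t iG Gn tn tr.
move=> /= ->; move: (indeg G _) (kids G t) (grandkids G t) (indeg_le_size G (parent G t)) => d c z dG.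
have lam0 : 0 <= d%:R + a by rewrite addr_ge0// ltW.
apply: lyapunov_step => //.
move: dG; rewrite Gn -(@ler_nat R) denomE => dn.
have : 1 <= n%:R :> R by rewrite ler1n; case/andP: tn => /leq_trans h1 /h1.
nra.
Qed.

Lemma exp_potentialZ t p theta L h r n :
  exp_potential t p theta L (fun d => r * h d) n = r * exp_potential t p theta L h n.
Proof.
by rewrite /exp_potential -BO_expectZ; apply: eq_BO_expect => G _ _; ring.
Qed.

Lemma exp_potentialD t p theta L h1 h2 n : exp_potential t p theta L (fun d => h1 d + h2 d) n =
  exp_potential t p theta L h1 n + exp_potential t p theta L h2 n.
Proof.
by rewrite /exp_potential -BO_expectD; apply: eq_BO_expect => G _ _; ring.
Qed.

Lemma sum_iota1S (F : nat -> R) n :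
  \sum_(s <- iota 1 n.+1) F s = \sum_(s <- iota 1 n) F s + F n.+1.
Proof. by rewrite iota1S big_rcons. Qed.

(** At its birth t has neither children nor grandchildren, and it has just
increased the indegree of its parent by one. *)
Lemma exp_potential_init (a0 : 0 < a) m p theta L h :
  exp_potential m.+1 p theta L h m.+1 = rising p (potential theta L 0 0) / denom a m *
    BO_expect a m (fun G => \sum_(s <- iota 1 m) rate a G s * h (indeg G s).+1).
Proof.
rewrite -BO_expectZ /exp_potential BO_expectS//; apply: eq_BO_expect => G iG Gn.
have last0 : nonroot (extend G m.+1) m.+1 = 0 by rewrite /nonroot /is_root/= Gn !eqxx.
rewrite mulrAC; congr (_ / _); rewrite sum_iota1S last0 mul0r mulr0 addr0 mulr_sumr.
rewrite big_seq [RHS]big_seq; apply: eq_bigr => s.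
rewrite mem_iota add1n ltnS => /andP[s1 sm].
have sG : (0 < s <= size G)%N by rewrite Gn s1.
have -> : kids (extend G s) m.+1 = 0%N.
  rewrite /kids /extend/= Gn eqxx andbF add0n; apply/eqP; rewrite -leqn0 leqNgt -has_count.
  apply/hasPn => e eG; have /andP[/andP[_ e2] en] := increasing_mem iG eG.
  by rewrite ltn_eqF// ltnS (leq_trans e2)// -Gn.
have -> : grandkids (extend G s) m.+1 = 0%N.
  rewrite /extend Gn; have small v : (0 < v <= size G)%N -> is_child ((m.+1, s) :: G) m.+1 v = false.
    move=> vG; have /andP[_ pv] := parent_bounds iG vG.
    move: vG => /andP[v0]; rewrite Gn => vm.
    rewrite /is_child/= [m.+1 == v]gtn_eqF// ltn_eqF// ltnS.
    exact: leq_trans vm.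
  rewrite /grandkids/= small// add0n; apply/eqP; rewrite -leqn0 leqNgt -has_count.
  apply/hasPn => e eG; have /andP[/andP[e0 e2] en] := increasing_mem iG eG.
  by rewrite small// e0 (leq_trans e2).
rewrite /nonroot /is_root/= Gn eqxx ltn_eqF// mul1r eqxx add1n.
by rewrite mulrA mulrC.
Qed.

Lemma potential0_le (a0 : 0 < a) theta L : 0 < L -> 0 <= theta <= L -> potential theta L 0 0 <= a.
Proof.
move=> L0 /andP[t0 tL]; rewrite /potential !add0r ler_pdivrMr// mulrC ler_wpM2l//.
exact: ltW.
Qed.
End Lyapunov.

(** * Moments of the number of grandchildren *)

Section Moments.
Variables (R : realType) (a : R).

(** The accumulated attachment rate between the times m and n, of order
ln (n / m) / (a + 1). *)
Definition harm (m n : nat) : R := \sum_(m <= i < n) (denom a i)^-1.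

Lemma harm_id n : harm n n = 0.
Proof. by rewrite /harm big_geq. Qed.

Lemma harmS m n : (m <= n)%N -> harm m n.+1 = harm m n + (denom a n)^-1.
Proof. exact: big_nat_recr. Qed.

Lemma harm_recl m n : (m < n)%N -> harm m n = harm m.+1 n + (denom a m)^-1.
Proof. by move=> mn; rewrite /harm big_ltn// addrC. Qed.

Lemma harm_ge0 (a0 : 0 < a) m n : 0 <= harm m n.
Proof. by apply: sumr_ge0 => i _; rewrite invr_ge0 ltW// denom_gt0. Qed.

Lemma harm_homo (a0 : 0 < a) m m' n : (m <= m' <= n)%N -> harm m' n <= harm m n.
Proof.
move=> /andP[mm m'n]; rewrite /harm (big_cat_nat mm m'n)/= lerDr.
exact: harm_ge0.
Qed.

Lemma inv_le_ln (y : R) : 0 < y -> (y + 1)^-1 <= ln ((y + 1) / y).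
Proof.
move=> y0; have y1 : 0 < y + 1 by lra.
have q0 : 0 < (y + 1)^-1 by rewrite invr_gt0.
have e : 1 + - (y + 1)^-1 = y / (y + 1) by field; rewrite gt_eqF.
have : -1 < - (y + 1)^-1 by rewrite ltrN2 invf_lt1//; lra.
by move/le_ln1Dx; rewrite e -[y / _]invf_div lnV ?lerN2// posrE divr_gt0.
Qed.

Lemma harm_le (a0 : 0 < a) m n : (0 < m <= n)%N ->
  (a + 1) * harm m n <= 1 + ln (n%:R / m%:R).
Proof.
move=> /andP[m0 mn]; have m0' : 0 < m%:R :> R by rewrite ltr0n.
(* The two reciprocals provide the slack for an induction on n. *)
suff : (a + 1) * harm m n <= m%:R^-1 - n%:R^-1 + ln (n%:R / m%:R).
  move=> /le_trans; apply; rewrite lerD2r.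
  have : m%:R^-1 <= 1 :> R by rewrite invf_le1// ler1n.
  have : 0 <= n%:R^-1 :> R by rewrite invr_ge0.
  lra.
elim: n mn => [|n IH]; first by rewrite leqn0 => /eqP m0n; rewrite m0n in m0.
rewrite leq_eqVlt => /predU1P[<-|].
  by rewrite harm_id mulr0 subrr add0r divff ?gt_eqF// ln1.
rewrite ltnS => mn; have n0 : (0 < n)%N := leq_trans m0 mn.
have n0' : 0 < n%:R :> R by rewrite ltr0n.
have n1' : 0 < n.+1%:R :> R by rewrite ltr0n.
rewrite harmS// mulrDr; have := IH mn; have := inv_le_ln n0'; rewrite natr1.
have -> : ln (n.+1%:R / m%:R) = ln (n%:R / m%:R) + ln (n.+1%:R / n%:R) :> R.
  rewrite -lnM ?posrE ?divr_gt0//; congr (ln _); field.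
  by rewrite !gt_eqF.
have : (a + 1) / denom a n <= n%:R^-1.
  rewrite ler_pdivrMr ?denom_gt0// ler_pdivlMl// denomE; lra.
move: (m%:R^-1) (n.+1%:R^-1) (n%:R^-1) ((a + 1) / _) (ln (n%:R / m%:R))
  (ln (n.+1%:R / n%:R)) => x y z u v w.
lra.
Qed.

(** The weight that a child must have at time n in order that, by
[exp_potentialS], it has weight 0 at time N, where only grandchildren are to
be counted. *)
Definition drift (p n N : nat) : R := p%:R * (2 * a + 1) * harm n N.

Lemma drift_bounds (a0 : 0 < a) p t n N : (t <= n <= N)%N ->
  0 <= drift p n N <= 1 + drift p t N.
Proof.
move=> tn; have q0 : 0 <= p%:R * (2 * a + 1) by rewrite mulr_ge0//; lra.
rewrite mulr_ge0 ?harm_ge0//=.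
have : drift p n N <= drift p t N by rewrite ler_wpM2l// harm_homo.
lra.
Qed.

Lemma drift_recl p n N : (n < N)%N ->
  drift p n N = drift p n.+1 N + p%:R * (2 * a + 1) / denom a n.
Proof. by move=> nN; rewrite /drift harm_recl// mulrDr. Qed.

Lemma eq_exp_potential t p theta L h1 h2 n : h1 =1 h2 ->
  exp_potential a t p theta L h1 n = exp_potential a t p theta L h2 n.
Proof. by move=> h12; apply: eq_BO_expect => G _ _; rewrite h12. Qed.

Lemma exp_potential_ge0 (a0 : 0 < a) t p theta L h n : 0 <= theta -> 0 < L ->
  (forall d, 0 <= h d) -> 0 <= exp_potential a t p theta L h n.
Proof.
move=> th0 L0 h0; apply: BO_expect_ge0 => // G _ _.
by rewrite mulr_ge0// mulr_ge0// rising_ge0// potential_ge0.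
Qed.

(** With a constant weight, each step of [exp_potentialS] costs a factor
1 + p / denom <= exp (p / denom). *)
Lemma exp_potential_total (a0 : 0 < a) p t n N : (0 < t <= n)%N -> (n <= N)%N ->
  exp_potential a t p (drift p n N) (1 + drift p t N) (fun=> 1) n <=
  rising p a * expR (p%:R * harm t n).
Proof.
move=> /andP[t0 tn] nN; have tN := leq_trans tn nN.
have /andP[L1 _] := @drift_bounds a0 p t t N ltac:(by rewrite leqnn).
have L0 : 0 < 1 + drift p t N by lra.
elim: n tn nN => [|n IH] tn nN; first by move: (leq_trans t0 tn).
move: tn; rewrite leq_eqVlt => /predU1P[tn|].
  subst t; rewrite harm_id mulr0 expR0 mulr1 exp_potential_init//.
  have th := @drift_bounds a0 p n.+1 n.+1 N ltac:(by rewrite leqnn).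
  have V0 := @potential_ge0 R a a0 (drift p n.+1 N) _ 0 0 (proj1 (andP th)) L0.
  rewrite -mulrA -[leRHS]mulr1; apply: ler_pM; rewrite ?rising_ge0 ?rising_homo ?potential0_le//.
    rewrite mulr_ge0 ?invr_ge0 ?(ltW (denom_gt0 _ _))//.
    apply: BO_expect_ge0 => // G _ _; apply: sumr_ge0 => s _.
    by rewrite mulr1 addr_ge0// ltW.
  rewrite ler_pdivrMl ?denom_gt0// mulr1 -[leRHS](BO_expect_cst a0 n).
  apply: le_BO_expect => // G iG Gn; rewrite -(sum_rate1 a iG Gn) sum_iota1S.
  under eq_bigr do rewrite mulr1.
  by rewrite lerDl addr_ge0// ltW.
rewrite ltnS => tn.
have T0 := denom_gt0 a0 n.
apply: (le_trans (@exp_potentialS R a a0 t p n _ _ _ _ _ _ _)); rewrite ?t0//; first by lra.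
  by apply: drift_bounds; rewrite // leqW.
rewrite -drift_recl// (@eq_exp_potential _ _ _ _ _ (fun d => (1 + p%:R / denom a n) * 1)); last first.
  by move=> d; field; rewrite gt_eqF.
rewrite exp_potentialZ harmS// mulrDr expRD mulrC [X in _ <= X]mulrA.
apply: ler_pM; rewrite ?expR_ge1Dx//.
- by apply: exp_potential_ge0 => //; case/andP: (@drift_bounds a0 p t n N ltac:(by rewrite tn (ltnW nN))).
- by rewrite addr_ge0// divr_ge0// ltW.
- by apply: IH => //; exact: ltnW.
Qed.

Lemma exp_potential_default t p theta L n j : (0 < t <= n)%N -> (n < j)%N ->
  exp_potential a t p theta L (fun d => (d == j)%:R) n = 0.
Proof.
move=> tn nj; rewrite /exp_potential /BO_expect big_seq big1// => x xn.
have [ix sx] := BO_law_increasing xn.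
rewrite [_ == j]ltn_eqF ?mul0r ?mulr0//.
by rewrite (leq_ltn_trans (indeg_le_size _ _))// sx.
Qed.

(** For the indicator of D = j, one step of [exp_potentialS] combines the values
at j and j - 1 just as [limpar_rec] does, so the profile [limpar a j] is
preserved from the birth of t on, where it comes from [expdeg_le], and each
step costs a factor 1 + (p + a) / denom. *)
Lemma exp_potential_joint (a0 : 0 < a) (n0 : nat) (K : R) : 1 <= a * n0%:R -> 0 < K ->
  (forall n i, (n0 <= n)%N -> expdeg a n i <= K * limdeg a i * (n%:R + time_shift a)) ->
  forall p t n N j, (n0 < t <= n)%N -> (n <= N)%N ->
  exp_potential a t p (drift p n N) (1 + drift p t N) (fun d => (d == j)%:R) n <=
  rising p a * (K / (a + 1)) * expR ((p%:R + a) * harm t n) * limpar a j.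
Proof.
move=> an0 K0 hK p t n N j /andP[n0t tn] nN; have tN := leq_trans tn nN.
have t0 : (0 < t)%N := leq_trans (ltn0Sn _) n0t.
have /andP[L1 _] := @drift_bounds a0 p t t N ltac:(by rewrite leqnn).
have L0 : 0 < 1 + drift p t N by lra.
have ra0 : 0 <= rising p a by rewrite rising_ge0 ?ltW.
have K1 : 0 <= K / (a + 1) by rewrite divr_ge0 ?(ltW K0)//; lra.
elim: n tn nN j => [|n IH] tn nN j; first by move: (leq_trans t0 tn).
move: tn; rewrite leq_eqVlt => /predU1P[tn|].
  subst t; rewrite harm_id mulr0 expR0 mulr1 exp_potential_init//.
  have th := @drift_bounds a0 p n.+1 n.+1 N ltac:(by rewrite leqnn).
  have V0 := @potential_ge0 R a a0 (drift p n.+1 N) _ 0 0 (proj1 (andP th)) L0.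
  rewrite -!mulrA; apply: ler_pM.
  - exact: rising_ge0.
  - rewrite mulr_ge0 ?invr_ge0 ?(ltW (denom_gt0 _ _))//.
    apply: BO_expect_ge0 => // G _ _; apply: sumr_ge0 => s _.
    by rewrite mulr_ge0// addr_ge0// ltW.
  - by rewrite rising_homo ?potential0_le.
  rewrite ler_pdivrMl ?denom_gt0//.
  case: j => [|j].
    rewrite (_ : BO_expect _ _ _ = 0).
      rewrite mulr_ge0 ?(ltW (denom_gt0 a0 n))// mulrA mulr_ge0 ?(ltW (limpar_gt0 a0 _))//.
    rewrite -[RHS](BO_expect_cst a0 n); apply: eq_BO_expect => G _ _.
    by rewrite big1// => s _; rewrite mulr0.
  apply: (@le_trans _ _ ((j%:R + a) * expdeg a n j)).
    rewrite /expdeg -BO_expectZ; apply: le_BO_expect => // G iG Gn.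
    rewrite sum_iota1S mulrDr mulr_sumr -[leLHS]addr0; apply: lerD; last first.
      by rewrite mulr_ge0// addr_ge0// ltW.
    apply: ler_sum => s _; rewrite eqSS /rate.
    by case: eqP => [->//|_]; rewrite !mulr0.
  apply: (le_trans (ler_wpM2l _ (hK n j n0t))); first by rewrite addr_ge0 ?(ltW a0).
  rewrite limparS// denom_shift// le_eqVlt; apply/orP; left; apply/eqP; field.
  by rewrite gt_eqF//; lra.
rewrite ltnS => tn.
have T0 := denom_gt0 a0 n.
have [nj|jn] := ltnP n.+1 j.
  rewrite exp_potential_default//; last by rewrite t0 leqW.
  exact: mulr_ge0 (mulr_ge0 (mulr_ge0 ra0 K1) (expR_ge0 _)) (ltW (limpar_gt0 a0 j)).
apply: (le_trans (@exp_potentialS R a a0 t p n _ _ _ _ _ _ _)); rewrite ?t0//; first by lra.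
  by apply: drift_bounds; rewrite // leqW.
rewrite -drift_recl// (@eq_exp_potential _ _ _ _ _ (fun d =>
   (1 + (p%:R - (j%:R + a)) / denom a n) * (d == j)%:R +
   (if j is i.+1 then (i%:R + a) / denom a n else 0) * (d == j.-1)%:R)); last first.
  move=> d; case: (j) => [|i] /=.
    by case: eqP => [->|_] /=; field; rewrite gt_eqF.
  rewrite eqSS; have [->|_] := eqVneq d i.
    by rewrite [i == i.+1]ltn_eqF//=; field; rewrite gt_eqF.
  by case: eqP => [->|_] /=; field; rewrite gt_eqF.
rewrite exp_potentialD !exp_potentialZ harmS// mulrDr expRD.
set B := rising p a * (K / (a + 1)) * expR ((p%:R + a) * harm t n).
have B0 : 0 <= B := mulr_ge0 (mulr_ge0 ra0 K1) (expR_ge0 _).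
have IHj i := IH tn (ltnW nN) i.
have c1 : 0 <= 1 + (p%:R - (j%:R + a)) / denom a n.
  have h := rate_le_denomS a0 an0 (leq_trans (ltnW n0t) tn) jn.
  rewrite (_ : _ + _ = (denom a n - (j%:R + a) + p%:R) / denom a n).
    by rewrite divr_ge0 ?(ltW T0)// addr_ge0// subr_ge0.
  by field; rewrite gt_eqF.
have c2 : 0 <= (if j is i.+1 then (i%:R + a) / denom a n else 0).
  by case: (j) => // i; rewrite divr_ge0 ?(ltW T0)// addr_ge0// ltW.
apply: (le_trans (lerD (ler_wpM2l c1 (IHj j)) (ler_wpM2l c2 (IHj j.-1)))).
rewrite -/B; apply: (@le_trans _ _ (B * (1 + (p%:R + a) / denom a n) * limpar a j)); last first.
  rewrite ler_wpM2r ?(ltW (limpar_gt0 a0 _))// mulrA -/B ler_wpM2l//.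
  exact: expR_ge1Dx.
case: j {jn c1 c2 IHj} => [|j] /=.
  have h : 0 <= B * limpar a 0 / denom a n.
    exact: divr_ge0 (mulr_ge0 B0 (ltW (limpar_gt0 a0 0))) (ltW T0).
  rewrite -subr_ge0 (_ : _ - _ = B * limpar a 0 / denom a n * (2 * a)); last by ring.
  by rewrite mulr_ge0//; lra.
rewrite le_eqVlt; apply/orP; left; apply/eqP.
have := limpar_rec a0 j => h.
have -> : (j%:R + a) / denom a n * (B * limpar a j) = (j%:R + a) * limpar a j * B / denom a n by ring.
rewrite -h -natr1; ring.
Qed.

Lemma drift_le (a0 : 0 < a) p t N : (0 < t <= N)%N ->
  1 + drift p t N <= (1 + 2 * p%:R) * (1 + ln (N%:R / t%:R)).
Proof.
move=> tN; have := harm_le a0 tN; have := harm_ge0 a0 t N.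
have ln0 : 0 <= ln (N%:R / t%:R) :> R.
  by rewrite ln_ge0// ler_pdivlMr ?ltr0n ?mul1r ?ler_nat; case/andP: tN.
have p0 : 0 <= p%:R :> R by [].
rewrite /drift; move: (harm t N) (ln _) ln0 p%:R p0 => H l l0 q q0 H0 H1.
have : (2 * a + 1) * H <= 2 * (1 + l) by nra.
move/(ler_wpM2l q0); nra.
Qed.

Lemma expR_harm_le (a0 : 0 < a) q t N : 0 <= q -> (0 < t <= N)%N ->
  expR (q * harm t N) <= expR (q / (a + 1)) * (N%:R / t%:R) `^ (q / (a + 1)).
Proof.
move=> q0 tN; have a1 : 0 < a + 1 by lra.
have x0 : 0 < N%:R / t%:R :> R.
  by case/andP: tN => t0 /(leq_trans t0) N0; rewrite divr_gt0 ?ltr0n.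
rewrite /powR gt_eqF// -expRD ler_expR.
rewrite (_ : _ + _ = q * ((a + 1)^-1 * (1 + ln (N%:R / t%:R)))); last by ring.
by rewrite ler_wpM2l// ler_pdivlMl// harm_le.
Qed.

(** At the final time the drift vanishes, the potential is the number of
grandchildren divided by L, and powers are below rising factorials. *)
Lemma grandkids_moment p t N (h : nat -> R) (a0 : 0 < a) : (0 < t <= N)%N ->
  (forall d, 0 <= h d) ->
  BO_expect a N (fun G => nonroot R G t * (h (indeg G (parent G t)) *
     (grandkids G t)%:R ^+ p)) <=
  ((1 + 2 * p%:R) * (1 + ln (N%:R / t%:R))) ^+ p *
    exp_potential a t p (drift p N N) (1 + drift p t N) h N.
Proof.
move=> tN h0; rewrite /exp_potential -BO_expectZ; apply: le_BO_expect => // G iG Gn.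
rewrite [leRHS]mulrCA; set L := 1 + drift p t N.
have L0 : 0 < L.
  have := @drift_bounds a0 p t t N ltac:(by rewrite leqnn; case/andP: tN).
  by rewrite /L => /andP[]; lra.
rewrite ler_wpM2l ?ler0n// [leRHS]mulrCA ler_wpM2l//.
apply: (@le_trans _ _ (L ^+ p * rising p (potential a (drift p N N) L (kids G t) (grandkids G t)))).
  rewrite /drift harm_id mulr0 /potential mul0r addr0.
  have Z0 : 0 <= (grandkids G t)%:R / L by rewrite divr_ge0// ltW.
  apply: le_trans (ler_wpM2l _ (expr_le_rising p Z0)); last by rewrite exprn_ge0// ltW.
  by rewrite -exprMn mulrCA divff ?mulr1// gt_eqF.
rewrite ler_wpM2r ?rising_ge0 ?potential_ge0 ?mulr_ge0 ?harm_ge0//; first by lra.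
by rewrite lerXn2r ?nnegrE ?(ltW L0)// ?drift_le// (le_trans (ltW L0))// drift_le.
Qed.

(** The grandchildren of a vertex of age ratio x = N / t number about
x^(1 / (a + 1)) up to logarithms, and fixing the indegree j of the parent
costs the factor limpar a j * x^(a / (a + 1)). *)
Lemma joint_moment (a0 : 0 < a) (n0 : nat) p : 1 <= a * n0%:R ->
  exists2 C : R, 0 < C & forall t N j, (n0 < t <= N)%N ->
  BO_expect a N (fun G => nonroot R G t * ((indeg G (parent G t) == j)%:R *
     (grandkids G t)%:R ^+ p)) <=
  C * limpar a j * (N%:R / t%:R) `^ ((p%:R + a) / (a + 1)) * (1 + ln (N%:R / t%:R)) ^+ p.
Proof.
move=> an0; have [K K0 hK] := expdeg_le a0 an0.
have ra0 : 0 <= rising p a by rewrite rising_ge0 ?ltW.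
have pa0 : 0 <= p%:R + a by rewrite addr_ge0// ltW.
have a10 : 0 <= a + 1 by lra.
set q := (p%:R + a) / (a + 1).
pose C := (1 + 2 * p%:R) ^+ p * (rising p a * (K / (a + 1)) * expR q).
have C0 : 0 <= C.
  by rewrite /C !mulr_ge0 ?exprn_ge0 ?invr_ge0 ?expR_ge0 ?(ltW K0)// addr_ge0// mulr_ge0.
exists (C + 1) => [|t N j tN]; first by rewrite ltr_wpDl.
have t0 : (0 < t)%N by case/andP: tN => /(leq_ltn_trans (leq0n _)).
have tN' : (0 < t <= N)%N by rewrite t0; case/andP: tN.
have x0 : 0 < N%:R / t%:R :> R.
  by case/andP: tN' => _ /(leq_trans t0) N0; rewrite divr_gt0 ?ltr0n.
have ln0 : 0 <= ln (N%:R / t%:R) :> R.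
  by rewrite ln_ge0// ler_pdivlMr ?ltr0n ?mul1r ?ler_nat; case/andP: tN'.
have l0 : 0 <= (1 + ln (N%:R / t%:R)) ^+ p :> R by rewrite exprn_ge0// addr_ge0.
apply: (le_trans (@grandkids_moment p t N (fun d => (d == j)%:R) a0 tN' _)) => //.
have := @exp_potential_joint a0 n0 K an0 K0 hK p t N N j tN (leqnn _).
rewrite exprMn => h.
apply: (le_trans (ler_wpM2l _ h)).
  by rewrite mulr_ge0// exprn_ge0// addr_ge0// mulr_ge0.
have e := @expR_harm_le a0 (p%:R + a) t N pa0 tN'.
rewrite -/q in e.
have P0 := ltW (limpar_gt0 a0 j).
apply: (@le_trans _ _ (C * limpar a j * (N%:R / t%:R) `^ q * (1 + ln (N%:R / t%:R)) ^+ p)).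
  rewrite (_ : _ * limpar a j * _ * _ = (1 + 2 * p%:R) ^+ p * (1 + ln (N%:R / t%:R)) ^+ p *
    (rising p a * (K / (a + 1)) * (expR q * (N%:R / t%:R) `^ q) * limpar a j)); last first.
    by rewrite /C; ring.
  rewrite ler_wpM2l ?mulr_ge0 ?exprn_ge0 ?addr_ge0 ?mulr_ge0//.
  have K1 : 0 <= K / (a + 1) by rewrite divr_ge0 ?(ltW K0).
  by rewrite ler_wpM2r// ler_wpM2l// mulr_ge0.
by rewrite !ler_wpM2r ?powR_ge0// lerDl.
Qed.

Lemma total_moment (a0 : 0 < a) p :
  exists2 C : R, 0 < C & forall t N, (0 < t <= N)%N ->
  BO_expect a N (fun G => nonroot R G t * (grandkids G t)%:R ^+ p) <=
  C * (N%:R / t%:R) `^ (p%:R / (a + 1)) * (1 + ln (N%:R / t%:R)) ^+ p.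
Proof.
have ra0 : 0 <= rising p a by rewrite rising_ge0 ?ltW.
set q := p%:R / (a + 1).
pose C := (1 + 2 * p%:R) ^+ p * (rising p a * expR q).
have C0 : 0 <= C.
  by rewrite /C !mulr_ge0 ?exprn_ge0 ?expR_ge0// addr_ge0// mulr_ge0.
exists (C + 1) => [|t N tN]; first by rewrite ltr_wpDl.
have t0 : (0 < t)%N by case/andP: tN.
have ln0 : 0 <= ln (N%:R / t%:R) :> R.
  by rewrite ln_ge0// ler_pdivlMr ?ltr0n ?mul1r ?ler_nat; case/andP: tN.
have l0 : 0 <= (1 + ln (N%:R / t%:R)) ^+ p :> R by rewrite exprn_ge0// addr_ge0.
have := @grandkids_moment p t N (fun=> 1) a0 tN (fun=> ler01).
rewrite (@eq_BO_expect _ _ _ _ (fun G => nonroot R G t * (grandkids G t)%:R ^+ p)); last first.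
  by move=> G _ _; rewrite mul1r.
move=> /le_trans; apply.
have tNN : (0 < t <= N)%N && (N <= N)%N by rewrite tN leqnn.
have h := @exp_potential_total a0 p t N N tN (leqnn _).
rewrite exprMn; apply: (le_trans (ler_wpM2l _ h)).
  by rewrite mulr_ge0// exprn_ge0// addr_ge0// mulr_ge0.
have e := @expR_harm_le a0 p%:R t N (ler0n _ _) tN; rewrite -/q in e.
apply: (@le_trans _ _ (C * (N%:R / t%:R) `^ q * (1 + ln (N%:R / t%:R)) ^+ p)).
  rewrite (_ : C * _ * _ = (1 + 2 * p%:R) ^+ p * (1 + ln (N%:R / t%:R)) ^+ p *
    (rising p a * (expR q * (N%:R / t%:R) `^ q))); last by rewrite /C; ring.
  rewrite ler_wpM2l ?mulr_ge0 ?exprn_ge0 ?addr_ge0 ?mulr_ge0//.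
  by rewrite ler_wpM2l.
by rewrite !ler_wpM2r ?powR_ge0// lerDl.
Qed.
End Moments.

(** * Elementary sums and logarithms *)

Section Sums.
Variable R : realType.

Lemma sum_inv_telescope (y : R) n : 0 < y ->
  \sum_(i < n) ((y + i%:R) * (y + i%:R + 1))^-1 <= y^-1.
Proof.
move=> y0.
suff -> : \sum_(i < n) ((y + i%:R) * (y + i%:R + 1))^-1 = y^-1 - (y + n%:R)^-1.
  by rewrite lerBlDr lerDl invr_ge0 addr_ge0// ltW.
elim: n => [|n IH]; first by rewrite big_ord0 addr0 subrr.
rewrite big_ord_recr/= IH -natr1.
have n0 : 0 <= n%:R :> R by [].
by field; rewrite !gt_eqF//; lra.
Qed.

Lemma sum_inv_le_ln (y : R) n : 0 < y ->
  \sum_(t <- iota 1 n) (t%:R + y)^-1 <= ln ((n%:R + y) / y).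
Proof.
move=> y0; elim: n => [|n IH].
  by rewrite big_nil add0r divff ?gt_eqF// ln1.
have ny : 0 < n%:R + y by rewrite nat_shift_gt0.
rewrite sum_iota1S -[n.+1%:R]natr1 addrAC.
have -> : (n%:R + y + 1) / y = (n%:R + y) / y * ((n%:R + y + 1) / (n%:R + y)).
  by field; rewrite !gt_eqF.
have n1y : 0 < n%:R + y + 1 by lra.
rewrite lnM ?posrE ?divr_gt0//; apply: lerD => //; exact: inv_le_ln.
Qed.

(** Comparison with the telescoping sum of y^2 / ((y + i) (y + i + 1)). *)
Lemma sum_inv_sq_le (y : R) n : 0 < y ->
  \sum_(t <- iota 1 n) (y / (y + t%:R)) ^+ 2 <= y.
Proof.
move=> y0.
apply: (@le_trans _ _ (\sum_(i < n) y ^+ 2 * ((y + i%:R) * (y + i%:R + 1))^-1)).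
  rewrite -(addn0 1%N) iotaDl big_map -[X in iota _ X]subn0 -/(index_iota 0 n) big_mkord.
  apply: ler_sum => i _; rewrite exprMn exprVn -natr1.
  have i0 : 0 <= i%:R :> R by [].
  rewrite ler_wpM2l ?exprn_ge0 ?(ltW y0)// lef_pV2 ?posrE ?exprn_gt0 ?mulr_gt0//; lra.
rewrite -mulr_sumr; apply: (le_trans (ler_wpM2l _ (sum_inv_telescope n y0))).
  by rewrite exprn_ge0// ltW.
by rewrite expr2 mulfK// gt_eqF.
Qed.

Lemma sum_index_le1 (D k z : nat) : (\sum_(i < z) (D + i.+1 == k) <= 1)%N.
Proof.
rewrite -(big_mkord predT (fun i => (D + i.+1 == k) : nat)) -count_sumb.
rewrite (@eq_in_count _ _ (fun i => (D < k)%N && (i == k - D.+1)%N)); last first.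
  by move=> i _ /=; apply/eqP/andP => [h|[h /eqP ->]]; [split; [lia|apply/eqP; lia]|lia].
rewrite (leq_trans (sub_count _ _) (_ : count (pred1 (k - D.+1)%N) _ <= 1)%N)//.
  by move=> i /andP[].
by rewrite count_uniq_mem ?iota_uniq//; case: (_ \in _).
Qed.
End Sums.

Section Logarithms.
Variables (R : realType) (a : R).

(** The logarithm to base 2 is at least 1 at every k > 1, so that its powers
increase with the exponent. *)
Definition lg (k : nat) : R := ln k%:R / ln 2.

Lemma ln2_bounds : 0 < ln 2 :> R /\ ln 2 <= 1 :> R.
Proof.
split; first by rewrite ln_gt0// ltr1n.
by rewrite (_ : 2 = 1 + 1)// le_ln1Dx//; lra.
Qed.

Lemma lg_ge1 k : (1 < k)%N -> 1 <= lg k.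
Proof.
have [l0 _] := ln2_bounds; move=> k1; rewrite /lg ler_pdivlMr// mul1r.
by rewrite ler_ln ?posrE ?ltr0n// ?ler_nat//; exact: ltnW.
Qed.

Lemma ln_le_lg k : (1 < k)%N -> ln k%:R <= lg k.
Proof.
have [l0 l1] := ln2_bounds; move=> k1; have := lg_ge1 k1.
rewrite /lg => h; rewrite ler_pdivlMr// ler_piMr//.
by rewrite ln_ge0// ler1n ltnW.
Qed.

End Logarithms.

(** * Roots *)

Section RootCount.
Variables (R : realType) (a : R).

(** Each new vertex becomes a root with probability a / denom. *)
Lemma exp_roots (a0 : 0 < a) n :
  BO_expect a n (fun G => (count (is_root G) (iota 1 n))%:R) = a * harm a 0 n.
Proof.
elim: n => [|n IH].
  by rewrite harm_id mulr0 /= BO_expect_cst.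
rewrite BO_expectS// harmS// mulrDr -IH -[a / _ in RHS](BO_expect_cst a0 n) -BO_expectD.
apply: eq_BO_expect => G iG Gn.
transitivity ((\sum_(s <- iota 1 n.+1) (rate a G s * (count (is_root G) (iota 1 n))%:R +
   rate a G s * (s == n.+1)%:R)) / denom a n).
  congr (_ / _); rewrite big_seq [RHS]big_seq; apply: eq_bigr => s.
  rewrite mem_iota add1n ltnS => /andP[s1 sn]; rewrite -mulrDr -natrD; congr (_ * _%:R).
  rewrite iota1S -cats1 count_cat/= addn0; congr (_ + _)%N; last first.
    by rewrite /is_root/= Gn eqxx.
  apply: eq_in_count => v; rewrite mem_iota add1n ltnS => /andP[v1 vn].
  by rewrite /is_root parent_cons// Gn.
rewrite big_split -mulr_suml sum_rate1// sum_pick ?leqnn// /rate indeg_default ?Gn//.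
by rewrite add0r mulrDl mulrAC divff ?mul1r// gt_eqF// denom_gt0.
Qed.

Lemma exp_roots_le (a0 : 0 < a) n : (0 < n)%N ->
  BO_expect a n (fun G => (count (is_root G) (iota 1 n))%:R) <= 2 + ln n%:R.
Proof.
move=> n0; rewrite exp_roots// harm_recl// mulrDr denomE mulr0 add0r divff ?gt_eqF//.
have n01 : (0 < 1 <= n)%N by [].
have := harm_le a0 n01; rewrite divr1; have := harm_ge0 a0 1 n.
nra.
Qed.
End RootCount.

(** * Vertices with many grandchildren *)

Section Thresholds.
Variables (R : realType) (a : R).

Lemma powRM_expr (x v b : R) (p : nat) : 0 <= x -> 0 <= v -> 0 < b ->
  (x * v `^ b) `^ (p%:R / b) = x `^ (p%:R / b) * v ^+ p.
Proof.
move=> x0 v0 b0; rewrite powRM ?powR_ge0//; congr (_ * _).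
by rewrite -powRrM mulrCA divff ?gt_eqF// mulr1 powR_mulrn.
Qed.

Lemma half_bounds k : (1 < k)%N -> (0 < k./2)%N /\ (k <= 3 * k./2)%N.
Proof.
move=> k1; have := odd_double_half k; rewrite -addnn; case: (odd k) => /= h; split; lia.
Qed.

(** From the time n / k^(1 + a) on, the age ratio is at most k^(1 + a). *)
Lemma log_ratio_le (a0 : 0 < a) n k t : (1 < k)%N -> (0 < t <= n)%N ->
  n%:R / k%:R `^ (1 + a) <= t%:R -> 1 + ln (n%:R / t%:R) <= (2 + a) * lg R k.
Proof.
move=> k1 /andP[t0 tn]; have k0 : 0 < k%:R :> R by rewrite ltr0n ltnW.
have t0' : 0 < t%:R :> R by rewrite ltr0n.
have n0' : 0 < n%:R :> R by rewrite ltr0n (leq_trans t0).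
have p0 : 0 < k%:R `^ (1 + a) :> R by rewrite powR_gt0.
rewrite ler_pdivrMr// mulrC -ler_pdivrMr// => h.
have : ln (n%:R / t%:R) <= (1 + a) * ln k%:R.
  by rewrite -ln_powR ler_ln ?posrE ?divr_gt0.
have := lg_ge1 R k1; have := ln_le_lg R k1.
move: (lg R k) (ln _) (ln _) => u v w uv u1 vw; nra.
Qed.

Lemma ratio_ge1 n t : (0 < t <= n)%N -> 1 <= n%:R / t%:R :> R.
Proof. by move=> /andP[t0 tn]; rewrite ler_pdivlMr ?ltr0n// mul1r ler_nat. Qed.

(** With tau = n (lg k / k)^(1 + a), a vertex born long after tau typically has
less than k / 2 grandchildren. By Markov's inequality for a high moment
the probability of the contrary is O((tau / t)^2). The sum over t > tau of
this bound is O(tau), and so is the trivial bound for t <= tau. *)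
Lemma tail_sum (a0 : 0 < a) : exists2 C : R, 0 < C & forall n k, (0 < n)%N -> (1 < k)%N ->
  \sum_(t <- iota 1 n) BO_expect a n (fun G => nonroot R G t * (k./2 <= grandkids G t)%N%:R)
    <= C * (n%:R / k%:R `^ (1 + a) * lg R k `^ (1 + a)).
Proof.
have a10 : 0 < 1 + a by lra.
(* A moment of this order decays at least quadratically in t / tau. *)
pose P := (Num.bound (2 * (1 + a))).
have PP : 2 <= P%:R / (1 + a).
  by rewrite ler_pdivlMr//; apply/ltW/archi_boundP; lra.
have [C C0 hC] := total_moment a0 P.
pose B := (3 * (2 + a)) ^+ P.
have B0 : 0 <= B by rewrite exprn_ge0//; lra.
have CB0 : 0 <= C * B := mulr_ge0 (ltW C0) B0.
exists (4 * (1 + C * B)) => [|n k n0 k1]; first by rewrite mulr_gt0//; lra.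
have k0 : 0 < k%:R :> R by rewrite ltr0n ltnW.
have p0 : 0 < k%:R `^ (1 + a) :> R by rewrite powR_gt0.
have w1 := lg_ge1 R k1; set w := lg R k in w1 *.
have w0 : 0 < w by lra.
have wa1 : 1 <= w `^ (1 + a).
  by have := ler_powR w1 (ltW a10); rewrite powRr0.
set tau := _ * w `^ (1 + a).
have n0' : 0 < n%:R :> R by rewrite ltr0n.
have tau0 : 0 < tau by rewrite /tau mulr_gt0 ?powR_gt0// divr_gt0.
apply: (@le_trans _ _ (\sum_(t <- iota 1 n) 4 * (1 + C * B) * (tau / (tau + t%:R)) ^+ 2)); last first.
  by rewrite -mulr_sumr ler_wpM2l ?sum_inv_sq_le// mulr_ge0//; lra.
rewrite big_seq [leRHS]big_seq; apply: ler_sum => t; rewrite mem_iota add1n ltnS => tn.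
have [t0 _] := andP tn; have t0' : 0 < t%:R :> R by rewrite ltr0n.
have [ttau|taut] := leP t%:R tau.
  apply: (@le_trans _ _ 1).
    rewrite -[leRHS](BO_expect_cst a0 n); apply: le_BO_expect => // G _ _.
    by rewrite /nonroot; case: (~~ _); case: (k./2 <= _)%N; rewrite /= ?mulr0 ?mul0r ?mulr1.
  have h : 2^-1 <= tau / (tau + t%:R) by rewrite ler_pdivlMr; lra.
  have : 2^-1 ^+ 2 <= (tau / (tau + t%:R)) ^+ 2 by rewrite lerXn2r ?nnegrE//; lra.
  move: ((tau / _) ^+ 2) => q; rewrite exprVn => hq.
  have : 0 <= C * B * q by rewrite mulr_ge0//; lra.
  lra.
have [z0 kz3] := half_bounds k1.
have z0' : 0 < k./2%:R :> R by rewrite ltr0n.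
have kz : k%:R <= 3 * k./2%:R :> R by rewrite -natrM ler_nat.
have u0 : 0 < tau / t%:R by rewrite divr_gt0.
have u1 : tau / t%:R <= 1 by rewrite ler_pdivrMr// mul1r ltW.
have lx : 1 + ln (n%:R / t%:R) <= (2 + a) * w.
  apply: log_ratio_le => //; apply: le_trans (ltW taut); rewrite /tau ler_peMr//.
clearbody w.
have x1 := ratio_ge1 tn.
have ln0 : 0 <= ln (n%:R / t%:R) :> R by rewrite ln_ge0.
apply: (@le_trans _ _ (C * B * (tau / t%:R) ^+ 2)).
  apply: (@le_trans _ _ ((k./2%:R ^+ P)^-1 *
     BO_expect a n (fun G => nonroot R G t * (grandkids G t)%:R ^+ P))).
    rewrite -BO_expectZ; apply: le_BO_expect => // G _ _.
    rewrite mulrCA ler_wpM2l ?ler0n//.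
    case: leqP => [zZ|_] /=; last by rewrite mulr_ge0 ?invr_ge0 ?exprn_ge0.
    by rewrite ler_pdivlMl ?exprn_gt0// mulr1 lerXn2r ?nnegrE// ler_nat.
  apply: (le_trans (ler_wpM2l _ (hC t n tn))); first by rewrite invr_ge0 exprn_ge0.
  rewrite [a + 1]addrC.
  apply: (@le_trans _ _ (C * B * (tau / t%:R) `^ (P%:R / (1 + a)))); last first.
    rewrite ler_wpM2l// -powR_mulrn ?(ltW u0)//.
    by apply: ger_powR; rewrite ?u0.
  have -> : (tau / t%:R) `^ (P%:R / (1 + a)) =
      (n%:R / t%:R) `^ (P%:R / (1 + a)) * (w / k%:R) ^+ P.
    have -> : tau / t%:R = n%:R / t%:R * (w / k%:R) `^ (1 + a).
      rewrite powRM ?invr_ge0 ?(ltW w0) ?(ltW k0)// -(powR_inv1 (ltW k0)) -powRrM.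
      by rewrite mulN1r powRN /tau; ring.
    by apply: powRM_expr => //; exact: divr_ge0 (ltW w0) (ltW k0).
  rewrite mulrCA -!mulrA ler_pM2l// mulrCA.
  set X := (n%:R / t%:R) `^ _; have X0 : 0 <= X := powR_ge0 _ _.
  rewrite mulrCA [leRHS]mulrCA ler_wpM2l// /B -exprMn -exprVn -exprMn.
  have wk0 : 0 <= w / k%:R := divr_ge0 (ltW w0) (ltW k0).
  have a20 : 0 <= 2 + a by lra.
  rewrite lerXn2r ?nnegrE ?mulr_ge0 ?invr_ge0 ?addr_ge0 ?(ltW a0) ?(ltW w0)//.
  rewrite mulrC ler_pdivrMr// (le_trans lx)//.
  rewrite (_ : _ * (w / _) * _ = (2 + a) * w * (3 * k./2%:R / k%:R)); last by ring.
  by rewrite ler_peMr ?mulr_ge0 ?(ltW w0)// ler_pdivlMr// mul1r.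
have h : tau / t%:R <= 2 * (tau / (tau + t%:R)).
  rewrite mulrA ler_pdivlMr; last lra.
  by rewrite mulrAC ler_pdivrMr//; nra.
have := lerXn2r 2 _ _ h; rewrite !nnegrE => /(_ (ltW u0)).
have q0 : 0 <= tau / (tau + t%:R) by rewrite divr_ge0; lra.
rewrite mulr_ge0// => /(_ isT); rewrite [leRHS]exprMn.
have := sqr_ge0 (tau / (tau + t%:R)).
move: ((tau / (tau + t%:R)) ^+ 2) ((tau / t%:R) ^+ 2) => u v u00 vu.
have := ler_wpM2l CB0 vu; lra.
Qed.
End Thresholds.

(** * Parents of indegree just below the threshold *)

Section MiddleRange.
Variables (R : realType) (a : R).

(** The i-th event in [Y_le]: the indegree of the parent of t misses the
threshold by i + 1, and the grandchildren make up for it. *)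
Definition split_event (k i : nat) (t : nat) (G : multigraph) : bool :=
  [&& ~~ is_root G t, indeg G (parent G t) + i.+1 == k & i <= grandkids G t]%N.

(** Chebyshev's inequality with a free scale y: the event Z >= i has indicator at
most (y^2 + Z^2) / (y^2 + i^2), and the bound keeps the order of this while
being summable in i by telescoping. *)
Lemma split_event_bound (y : R) (k i t : nat) (G : multigraph) : 1 <= y -> (i < k)%N ->
  (split_event k i t G)%:R <= 4 * ((y + i%:R) * (y + i%:R + 1))^-1 *
    (y ^+ 2 * (nonroot R G t * ((indeg G (parent G t) == (k - i.+1)%N)%:R * (grandkids G t)%:R ^+ 0))
     + nonroot R G t * ((indeg G (parent G t) == (k - i.+1)%N)%:R * (grandkids G t)%:R ^+ 2)).
Proof.
move=> y1 ik; rewrite /split_event /nonroot.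
have y0 : 0 < y by lra.
have i0 : 0 <= i%:R :> R by [].
have -> : (indeg G (parent G t) + i.+1 == k)%N = (indeg G (parent G t) == k - i.+1)%N.
  by apply/eqP/eqP; lia.
set Z := grandkids G t.
have pos : 0 <= 4 * ((y + i%:R) * (y + i%:R + 1))^-1.
  by rewrite mulr_ge0// invr_ge0 mulr_ge0//; lra.
case: (~~ _); case: (_ == _) => /=; rewrite ?mul0r ?mulr0 ?addr0 ?mulr0//.
rewrite !mul1r expr0 mulr1.
have s0 : 0 <= y ^+ 2 + Z%:R ^+ 2 by rewrite addr_ge0 ?exprn_ge0// ltW.
case: leqP => [iZ|_]; last exact: mulr_ge0.
rewrite mulrAC ler_pdivlMr ?mulr_gt0//; try lra.
move: iZ; rewrite -(@ler_nat R) /= mul1r; move: (i%:R) (Z%:R) i0 => u v u0 uv.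
have h1 : (y + u) * (y + u + 1) <= 2 * (y + v) ^+ 2 by nra.
have := sqr_ge0 (y - v); nra.
Qed.

Lemma below_half k i : (i < k./2)%N ->
  [/\ (i < k)%N, (k <= 2 * (k - i.+1))%N & (0 < k - i.+1)%N].
Proof. by have := odd_double_half k; rewrite -addnn; split; lia. Qed.

(** The indegree of the parent is at least k / 2, which gives the factor
k^(- 1 - a) through [limpar]. The scale y in [split_event_bound] is the
typical number of grandchildren of t, x^(1 / (a + 1)) (1 + ln x) with
x = n / t, at which the zeroth and the second joint moment contribute equally;
the sum over i then costs y^2 / y, and the total is proportional to
x (1 + ln x). *)
Lemma middle_term (a0 : 0 < a) (n0 : nat) : 1 <= a * n0%:R ->
  exists2 C : R, 0 < C & forall n k t, (1 < k)%N -> (n0 < t <= n)%N ->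
  n%:R / k%:R `^ (1 + a) <= t%:R ->
  \sum_(i < k./2) BO_expect a n (fun G => (split_event k i t G)%:R) <=
  C * (n%:R / k%:R `^ (1 + a) * lg R k / t%:R).
Proof.
move=> an0.
have [C0 C00 h0] := joint_moment a0 0 an0; have [C2 C20 h2] := joint_moment a0 2 an0.
have [F F0 hF] := limpar_le_powR a0.
pose B := 4 * (C0 + C2) * (F * 2 `^ (1 + a)).
have B0 : 0 < B by rewrite !mulr_gt0 ?addr_gt0 ?powR_gt0.
exists (B * (2 + a)) => [|n k t k1 tn tbig]; first by rewrite mulr_gt0//; lra.
have t0 : (0 < t)%N by case/andP: tn => /(leq_ltn_trans (leq0n _)).
have tn' : (0 < t <= n)%N by rewrite t0; case/andP: tn.
have x1 := @ratio_ge1 R n t tn'.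
have lx := log_ratio_le a0 k1 tn' tbig.
have ln0 : 0 <= ln (n%:R / t%:R) :> R by rewrite ln_ge0.
have k0 : 0 < k%:R :> R by rewrite ltr0n ltnW.
have kk0 : 0 < k%:R `^ (1 + a) :> R by rewrite powR_gt0.
have [z0 _] := half_bounds k1.
set x := n%:R / t%:R in x1 lx ln0 *; set l := 1 + ln x in lx.
have l1 : 1 <= l by rewrite /l lerDl.
have x0 : 0 < x by lra.
have a1 : 0 < a + 1 by lra.
(* q * y^2 bounds the second joint moment, and y^2 times the zeroth one. *)
pose q := x `^ (a / (a + 1)); pose y := x `^ (1 / (a + 1)) * l.
have q0 : 0 < q by rewrite powR_gt0.
have y1 : 1 <= y.
  have h : 1 <= x `^ (1 / (a + 1)).
    by have := @ler_powR R x x1 0 (1 / (a + 1)); rewrite powRr0; apply; rewrite divr_ge0// ltW.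
  exact: mulr_ege1.
have y0 : 0 < y by lra.
have qy : q * y = x * l.
  rewrite /q /y mulrA -powRD; last by rewrite (gt_eqF x0) implybT.
  by rewrite -mulrDl divff ?gt_eqF// powRr1// ltW.
have e0 : x `^ ((0%:R + a) / (a + 1)) = q by rewrite add0r.
have e2 : x `^ ((2%:R + a) / (a + 1)) * l ^+ 2 = q * y ^+ 2.
  have ep : (x `^ (1 / (a + 1))) ^+ 2 = x `^ (2 / (a + 1)).
    by rewrite -powR_mulrn ?powR_ge0// -powRrM; congr (_ `^ _); ring.
  rewrite /y exprMn ep [RHS]mulrA /q -powRD; last by rewrite (gt_eqF x0) implybT.
  by congr (_ `^ _ * _); ring.
clearbody q y.
apply: (@le_trans _ _ (\sum_(i < k./2) ((y + i%:R) * (y + i%:R + 1))^-1 *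
   (B / k%:R `^ (1 + a) * (q * y ^+ 2)))); last first.
  rewrite -mulr_suml; apply: (le_trans (ler_wpM2r _ (sum_inv_telescope k./2 y0))).
    exact: mulr_ge0 (divr_ge0 (ltW B0) (ltW kk0)) (mulr_ge0 (ltW q0) (exprn_ge0 2 (ltW y0))).
  have -> : y^-1 * (B / k%:R `^ (1 + a) * (q * y ^+ 2)) = B / k%:R `^ (1 + a) * (q * y).
    by move: (B / _) => u; field; rewrite gt_eqF.
  rewrite qy (_ : _ * (_ / _) = B / k%:R `^ (1 + a) * (x * ((2 + a) * lg R k))); last first.
    by rewrite /x; ring.
  rewrite ler_wpM2l ?divr_ge0 ?(ltW B0) ?(ltW kk0)//.
  by rewrite ler_wpM2l// ltW.
apply: ler_sum => i _.
have [ik kj j0] := below_half (ltn_ord i).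
set j := (k - i.+1)%N in kj j0.
have fj : limpar a j <= F * 2 `^ (1 + a) / k%:R `^ (1 + a).
  apply: (le_trans (hF j j0)); rewrite -mulrA ler_pM2l//.
  have j0' : 0 < j%:R :> R by rewrite ltr0n.
  rewrite ler_pdivlMr// mulrC ler_pdivrMr ?powR_gt0// -powRM//.
  rewrite ge0_ler_powR ?nnegrE//; first lra.
  by rewrite -natrM ler_nat.
have h0j := h0 t n j tn; have h2j := h2 t n j tn.
have w0 : 0 <= ((y + i%:R) * (y + i%:R + 1))^-1.
  have i0 : 0 <= i%:R :> R by [].
  by rewrite invr_ge0 mulr_ge0//; lra.
apply: (@le_trans _ _ (4 * ((y + i%:R) * (y + i%:R + 1))^-1 *
    (y ^+ 2 * BO_expect a n (fun G => nonroot R G t *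
       ((indeg G (parent G t) == j)%:R * (grandkids G t)%:R ^+ 0))
     + BO_expect a n (fun G => nonroot R G t *
       ((indeg G (parent G t) == j)%:R * (grandkids G t)%:R ^+ 2))))).
  rewrite -BO_expectZ -BO_expectD -BO_expectZ; apply: le_BO_expect => // G _ _.
  exact: split_event_bound.
set W := ((y + _) * _)^-1 in w0 *.
have WE z : 4 * W * z = W * (4 * z) by ring.
rewrite WE.
apply: ler_wpM2l => //.
rewrite -/x -/l e0 [l ^+ 0]expr0 mulr1 in h0j.
rewrite -/x -/l -mulrA e2 in h2j.
have yy : 0 <= y ^+ 2 by rewrite exprn_ge0// ltW.
apply: (@le_trans _ _ (4 * (C0 + C2) * limpar a j * (q * y ^+ 2))).
  have := ler_wpM2l yy h0j.
  move: (BO_expect _ _ _) (BO_expect _ _ _) h2j => u v; lra.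
apply: ler_wpM2r; first exact: mulr_ge0 (ltW q0) yy.
have C020 : 0 <= 4 * (C0 + C2) by rewrite mulr_ge0// addr_ge0// ltW.
by apply: (le_trans (ler_wpM2l C020 fj)); rewrite /B -[leRHS]mulrA.
Qed.

End MiddleRange.

(** * Vertices of large second degree *)

Section SecondDegree.
Variables (R : realType) (a : R).

Lemma sum_le_threshold (n0 n : nat) : \sum_(t <- iota 1 n) (t <= n0)%N%:R <= n0%:R :> R.
Proof.
rewrite -natr_sum ler_nat -count_sumb -size_filter.
rewrite (@leq_trans (size (iota 1 n0)))//; last by rewrite size_iota.
apply: uniq_leq_size; first by rewrite filter_uniq// iota_uniq.
by move=> t; rewrite mem_filter !mem_iota !add1n !ltnS => /and3P[-> -> _].
Qed.

(** For given t and G at most one value of i is possible. *)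
Lemma split_event_sum_le1 (a0 : 0 < a) n k t z :
  \sum_(i < z) BO_expect a n (fun G => (split_event k i t G)%:R) <= 1.
Proof.
rewrite -BO_expect_sum -[leRHS](BO_expect_cst a0 n); apply: le_BO_expect => // G _ _.
rewrite -natr_sum -[1]/(1%:R) ler_nat.
apply: leq_trans (sum_index_le1 (indeg G (parent G t)) k z).
apply: leq_sum => i _; rewrite /split_event; case: (~~ _) => //=; case: (_ == _) => //=.
exact: leq_b1.
Qed.

(** Vertices born before m = n / k^(1 + a) are counted trivially. For the others
[middle_term] gives m * lg k / t, and the sum over t yields a second
logarithm. *)
Lemma middle_sum (a0 : 0 < a) : exists2 C : R, 0 < C & forall n k, (0 < n)%N -> (1 < k)%N ->
  \sum_(i < k./2) \sum_(t <- iota 1 n) BO_expect a n (fun G => (split_event k i t G)%:R) <=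
  C * (n%:R / k%:R `^ (1 + a) * lg R k ^+ 2 + k%:R).
Proof.
have [n0 n00 an0] := archi_threshold a0; have [C C0 hC] := middle_term a0 an0.
exists ((2 + 2 * C) * (2 + a) + n0%:R) => [|n k n1 k1].
  by rewrite addr_gt0 ?ltr0n// mulr_gt0//; lra.
have k0 : 0 < k%:R :> R by rewrite ltr0n ltnW.
have kk0 : 0 < k%:R `^ (1 + a) :> R by rewrite powR_gt0.
have kk1 : 1 <= k%:R `^ (1 + a) :> R.
  have k1' : 1 <= k%:R :> R by rewrite ler1n ltnW.
  by have := @ler_powR R _ k1' 0 (1 + a); rewrite powRr0; apply; lra.
have n0' : 0 < n%:R :> R by rewrite ltr0n.
have w1 := lg_ge1 R k1; have lw := ln_le_lg R k1.
have lnkk : ln (k%:R `^ (1 + a) + 1) <= (2 + a) * lg R k.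
  apply: (@le_trans _ _ (ln (2 * k%:R `^ (1 + a)))).
    by rewrite ler_ln ?posrE; lra.
  rewrite lnM ?posrE// ln_powR; have [l0 l1] := ln2_bounds R.
  have a10 : 0 <= 1 + a by lra.
  have := ler_wpM2l a10 lw; lra.
have lnkk0 : 0 <= ln (k%:R `^ (1 + a) + 1) :> R by rewrite ln_ge0//; lra.
set m := n%:R / _; have m0 : 0 < m by rewrite divr_gt0.
have mE : (n%:R + m) / m = k%:R `^ (1 + a) + 1.
  by rewrite /m; field; rewrite !gt_eqF.
rewrite exchange_big.
apply: (@le_trans _ _ (\sum_(t <- iota 1 n) ((t <= n0)%N%:R +
    (2 + 2 * C) * (m * lg R k) * (t%:R + m)^-1))).
  rewrite big_seq [leRHS]big_seq; apply: ler_sum => t; rewrite mem_iota add1n ltnS => tn.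
  have [t0 tn'] := andP tn; have t0' : 0 < t%:R :> R by rewrite ltr0n.
  have mw : m <= m * lg R k by rewrite ler_peMr// ltW.
  have r0 : 0 <= (2 + 2 * C) * (m * lg R k) * (t%:R + m)^-1.
    have c2 : 0 <= 2 + 2 * C by lra.
    have mw0 : 0 <= m * lg R k by lra.
    have tm0 : 0 <= t%:R + m by lra.
    exact: divr_ge0 (mulr_ge0 c2 mw0) tm0.
  case: leqP => tn0 /=.
    by apply: (le_trans (split_event_sum_le1 _ _ _ _ _)) => //; rewrite lerDl.
  rewrite add0r; have tm0 : 0 < t%:R + m by lra.
  have [tm|mt] := leP t%:R m.
    apply: (le_trans (split_event_sum_le1 _ _ _ _ _)) => //.
    rewrite ler_pdivlMr// mul1r.
    have : 0 <= C * (m * lg R k) by rewrite mulr_ge0//; lra.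
    lra.
  apply: (le_trans (hC n k t k1 _ (ltW mt))); first by rewrite tn0.
  rewrite -/m; set s := m * lg R k in mw r0 *; have s0 : 0 <= s by lra.
  clearbody s; rewrite [C * _]mulrA ler_pdivrMr// mulrAC ler_pdivlMr//.
  have := mulr_ge0 (ltW C0) s0 => cs.
  nra.
rewrite big_split -mulr_sumr [leRHS]mulrDr.
have S1 := sum_le_threshold n0 n; have S2 := sum_inv_le_ln n m0; rewrite mE in S2.
have w0 : 0 <= lg R k by lra.
have mw0 : 0 <= m * lg R k := mulr_ge0 (ltW m0) w0.
have c0 : 0 <= (2 + 2 * C) * (m * lg R k) by rewrite mulr_ge0//; lra.
have kn : n0%:R <= n0%:R * k%:R :> R by rewrite ler_peMr// ler1n ltnW.
have h := ler_wpM2l c0 (le_trans S2 lnkk).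
have e : (2 + 2 * C) * (m * lg R k) * ((2 + a) * lg R k) =
  (2 + 2 * C) * (2 + a) * (m * lg R k ^+ 2) by ring.
rewrite e in h.
have p1 : 0 <= n0%:R * (m * lg R k ^+ 2) by rewrite mulr_ge0// mulr_ge0 ?exprn_ge0// ltW.
have p2 : 0 <= (2 + 2 * C) * (2 + a) * k%:R by rewrite !mulr_ge0//; lra.
rewrite /=; move: (\sum_(t <- _) _) S1 (_ * \sum_(t <- _) _) h => u S1 v h.
rewrite !mulrDl; lra.
Qed.

Lemma expY_le (a0 : 0 < a) n k :
  BO_expect a n (fun G => (Y n k G)%:R) <=
  BO_expect a n (fun G => (count (is_root G) (iota 1 n))%:R) + exptail a n k
  + \sum_(t <- iota 1 n) BO_expect a n (fun G => nonroot R G t * (k./2 <= grandkids G t)%N%:R)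
  + \sum_(i < k./2) \sum_(t <- iota 1 n) BO_expect a n (fun G => (split_event k i t G)%:R).
Proof.
under [X in _ + X]eq_bigr do rewrite -BO_expect_sum.
rewrite -!BO_expect_sum -!BO_expectD; apply: le_BO_expect => // G iG Gn.
apply: (@le_trans _ _ (_%:R)); first by rewrite ler_nat; exact: (Y_le k k./2 iG Gn).
rewrite !natrD !natr_sum; apply: lerD; last first.
  by apply: ler_sum => i _; rewrite natr_sum.
apply: lerD => //; apply: ler_sum => t _.
by rewrite /nonroot -natrM mulnb.
Qed.

Lemma expY_ge (a0 : 0 < a) n k :
  exptail a n k.+1 <= BO_expect a n (fun G => (Y n k G)%:R) +
    BO_expect a n (fun G => (count (is_root G) (iota 1 n))%:R).
Proof.
rewrite -BO_expectD; apply: le_BO_expect => // G iG Gn.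
by rewrite -natrD ler_nat Y_ge.
Qed.

(** The number of roots is of order ln n = ln m + (1 + a) ln k, where
m = n / k^(1 + a). *)
Lemma roots_small (a0 : 0 < a) : exists2 C : R, 0 < C & forall n k, (0 < n)%N -> (1 < k)%N ->
  BO_expect a n (fun G => (count (is_root G) (iota 1 n))%:R) <=
  C * (n%:R / k%:R `^ (1 + a) + k%:R).
Proof.
exists (3 + a) => [|n k n0 k1]; first by lra.
have k0 : 0 < k%:R :> R by rewrite ltr0n ltnW.
have kk0 : 0 < k%:R `^ (1 + a) :> R by rewrite powR_gt0.
have n0' : 0 < n%:R :> R by rewrite ltr0n.
apply: (le_trans (exp_roots_le a0 n0)).
set m := n%:R / _; have m0 : 0 < m by rewrite divr_gt0.
have -> : n%:R = m * k%:R `^ (1 + a) by rewrite /m divfK// gt_eqF.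
rewrite lnM ?posrE// ln_powR.
have k2 : 2 <= k%:R :> R by rewrite ler_nat.
have := ln_sublinear m0; have := ln_sublinear k0.
move: (ln m) (ln k%:R) => u v vk um; nra.
Qed.

(** The propagation of errors from the bounds x' - r <= y <= r + x + t + s, where
x and x' are close to p and p', and p' is not much below p. *)
Lemma squeeze_error (c p p' x x' y r t s ep ef ex ex' er et es : R) :
  `|p - c| <= ep -> p - ef <= p' -> x' <= y + r -> y <= r + x + t + s ->
  `|x' - p'| <= ex' -> `|x - p| <= ex -> t <= et -> s <= es -> r <= er ->
  0 <= et -> 0 <= es -> 0 <= ef -> `|y - c| <= er + es + et + (ex + ex') + ep + ef.
Proof.
rewrite !ler_norml => /andP[? ?] ? ? ? /andP[? ?] /andP[? ?] ? ? ? ? ? ?.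
by apply/andP; split; lra.
Qed.

(** The sandwich of [expY_ge] and [expY_le] has main terms [exptail] at k + 1 and
k, which differ by little as limtail k - limtail (k + 1) is at most
limpar a k. The exponent e dominates both the square of the logarithm from
the middle range and its power 1 + a from the large grandchild counts. *)
Lemma expY_asymp (a0 : 0 < a) (e : R) : 2 <= e -> 1 + a <= e ->
  exists2 C : R, 0 < C & forall n k, (0 < n)%N -> (1 < k)%N ->
  `|BO_expect a n (fun G => (Y n k G)%:R) - n%:R * (tail_const a / k%:R `^ a)| <=
  C * (n%:R / k%:R `^ (1 + a) * lg R k `^ e + k%:R).
Proof.
move=> e2 ea.
have [Cr Cr0 hr] := roots_small a0; have [Cm Cm0 hm] := middle_sum a0.
have [Ct Ct0 ht] := tail_sum a0; have [Ce Ce0 he] := exptail_asymp a0.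
have [Cp Cp0 hp] := limtail_asymp a0; have [F F0 hF] := limpar_le_powR a0.
exists (Cr + Cm + Ct + 3 * Ce + Cp + F) => [|n k n0 k1]; first by lra.
have k0 : 0 < k%:R :> R by rewrite ltr0n ltnW.
have kk0 : 0 < k%:R `^ (1 + a) :> R by rewrite powR_gt0.
have n0' : 0 < n%:R :> R by rewrite ltr0n.
have w1 := lg_ge1 R k1.
have wp u : u <= e -> lg R k `^ u <= lg R k `^ e by move=> ue; exact: ler_powR.
have we1 : 1 <= lg R k `^ e by rewrite -(powRr0 (lg R k)) wp//; lra.
have we2 : lg R k ^+ 2 <= lg R k `^ e by rewrite -powR_mulrn ?wp//; lra.
have wea := wp _ ea.
have := hr n k n0 k1; have := hm n k n0 k1; have := ht n k n0 k1.
have := he n k (ltnW k1); have := he n k.+1 isT.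
have := expY_le a0 n k; have := expY_ge a0 n k.
set EY := BO_expect _ _ _; set ER := BO_expect _ _ _.
set T := \sum_(t <- _) _; set M := \sum_(i < _) _.
have gp : `|n%:R * limtail a k - n%:R * (tail_const a / k%:R `^ a)| <= Cp * (n%:R / k%:R `^ (1 + a)).
  rewrite -mulrBr normrM ger0_norm// mulrCA ler_wpM2l//; exact: hp.
have gs : n%:R * limtail a k - F * (n%:R / k%:R `^ (1 + a)) <= n%:R * limtail a k.+1.
  case: k k1 {k0 kk0 w1 wp we1 we2 wea EY ER T M gp} => [|[|k]] // k1.
  rewrite [limtail a k.+3]limtail_step// mulrBr lerD2l lerN2 [leRHS]mulrCA ler_wpM2l//.
  apply: le_trans (hF _ _) => //; rewrite /limpar ler_wpM2r ?(ltW (limdeg_gt0 a0 _))//; lra.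
set m := n%:R / _ in gp gs *; have m0 : 0 < m by rewrite divr_gt0.
have mw : m <= m * lg R k `^ e by rewrite ler_peMr// ltW.
have k11 : k.+1%:R <= 2 * k%:R :> R by rewrite -natrM ler_nat mul2n -addnn -addn1 leq_add2l ltnW.
have mw2 : m * lg R k ^+ 2 <= m * lg R k `^ e by rewrite ler_wpM2l// ltW.
have mwa : m * lg R k `^ (1 + a) <= m * lg R k `^ e by rewrite ler_wpM2l// ltW.
move=> yl yu he1 he2 ht' hm' hr'.
have he3 : Ce * k.+1%:R <= Ce * (2 * k%:R) by rewrite ler_wpM2l// ltW.
have K0 := ltW k0.
have m0' := ltW m0.
have w20 : 0 <= lg R k ^+ 2 := exprn_ge0 2 (le_trans ler01 w1).
have et0 := mulr_ge0 (ltW Ct0) (mulr_ge0 m0' (powR_ge0 (lg R k) (1 + a))).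
have es0 := mulr_ge0 (ltW Cm0) (addr_ge0 (mulr_ge0 m0' w20) K0).
have ef0 := mulr_ge0 (ltW F0) m0'.
apply: (le_trans (squeeze_error gp gs yl yu (le_trans he1 he3) he2 ht' hm' hr' et0 es0 ef0)).
have mon (D q q' : R) : 0 < D -> q <= q' -> D * q <= D * q'.
  by move=> D0 qq; rewrite ler_wpM2l// ltW.
have v0 : 0 <= m * lg R k `^ e := le_trans m0' mw.
set S := m * lg R k `^ e + k%:R.
have mS : m <= S := ler_wpDr K0 mw.
have KS : k%:R <= S by rewrite lerDr.
have mKS : m + k%:R <= S by rewrite lerD2r.
have mwS : m * lg R k ^+ 2 + k%:R <= S by rewrite lerD2r.
have mwaS : m * lg R k `^ (1 + a) <= S := ler_wpDr K0 mwa.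
have -> : Ce * k%:R + Ce * (2 * k%:R) = 3 * Ce * k%:R by ring.
clearbody S; do 5 rewrite [in leRHS]mulrDl.
by do 5 (apply: lerD; last by apply: mon => //; rewrite ?mulr_gt0); apply: mon.
Qed.
End SecondDegree.

(** The relative error is shared out in the proportion A : B. *)
Lemma split_relative_error (R : realType) (E Z A B : R) :
  0 < Z -> 0 <= A -> 0 < B -> `|E - Z| <= Z * (A + B) ->
  exists e1 e2 : R, [/\ `|e1| <= A, `|e2| <= B & E = Z * (1 + e1 + e2)].
Proof.
move=> Z0 A0 B0 h; have S0 : 0 < A + B by rewrite ltr_wpDl.
pose d := (E - Z) / Z / (A + B).
have d1 : `|d| <= 1.
  rewrite !normrM !normfV !(gtr0_norm Z0) (gtr0_norm S0).
  by rewrite ler_pdivrMr// ler_pdivrMr// mul1r mulrC.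
exists (d * A), (d * B); split.
- by rewrite normrM (ger0_norm A0) ler_piMl.
- by rewrite normrM (gtr0_norm B0) ler_piMl// ltW.
by rewrite -addrA -mulrDr /d; field; rewrite !gt_eqF.
Qed.

(** For the exponent e of [expY_asymp]. *)
Lemma ceil_exponent (R : realType) (a : R) : 0 < a ->
  2 <= (Num.ceil (a + 1))%:~R :> R /\ 1 + a <= (Num.ceil (a + 1))%:~R.
Proof.
move=> a0; have h := ceil_ge (a + 1); split; last by rewrite addrC.
rewrite -[2]/((1 + 1)%:~R) ler_int lezD1 -(ltr_int R).
by apply: lt_le_trans h; lra.
Qed.

Theorem theorem2 (R : realType) (a : R) (ha : 0 < a) :
  exists C : R, forall n k : nat, (0 < n)%N -> (1 < k)%N ->
  exists e1 e2 : R,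
    [/\ `|e1| <= C * (ln k%:R ^ Num.ceil (a + 1) / k%:R),
        `|e2| <= C * (k%:R `^ (1 + a) / n%:R) &
        BO_expect a n (fun G => (Y n k G)%:R) =
          (a + 1) * Gamma (2 * a + 1) / (Gamma (a + 1) * k%:R `^ a) * n%:R *
            (1 + e1 + e2)].
Proof.
set z := Num.ceil (a + 1).
have [z2 za] := ceil_exponent ha; rewrite -/z in z2 za.
have [C C0 hC] := expY_asymp ha z2 za.
have [l0 _] := ln2_bounds R; have lz0 : 0 < ln 2 ^ z :> R by exact: exprz_gt0.
have Y0 := tail_const_gt0 ha.
exists (C / tail_const a / ln 2 ^ z + C / tail_const a) => n k n0 k1.
have k0 : 0 < k%:R :> R by rewrite ltr0n ltnW.
have n0' : 0 < n%:R :> R by rewrite ltr0n.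
have lk0 : 0 < ln k%:R :> R by rewrite ln_gt0// ltr1n.
have ka0 : 0 < k%:R `^ a :> R by rewrite powR_gt0.
have kE : k%:R `^ (1 + a) = k%:R * k%:R `^ a :> R by rewrite powR1D.
have lgE : lg R k `^ z%:~R = ln k%:R ^ z / ln 2 ^ z.
  rewrite powR_intmul; last by rewrite divr_ge0// ltW.
  by rewrite /lg expfzMl expfV.
have G1 : Gamma (a + 1) != 0 by rewrite gt_eqF// Gamma_gt0; lra.
pose A : R := C / tail_const a / ln 2 ^ z * (ln k%:R ^ z / k%:R).
pose B : R := C / tail_const a * (k%:R `^ (1 + a) / n%:R).
pose Z : R := tail_const a / k%:R `^ a * n%:R.
have CY0 : 0 < C / tail_const a by rewrite divr_gt0.
have A0 : 0 <= A.
  have lkz : 0 <= ln k%:R ^ z :> R by rewrite exprz_ge0// ltW.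
  exact: mulr_ge0 (divr_ge0 (ltW CY0) (ltW lz0)) (divr_ge0 lkz (ltW k0)).
have B0 : 0 < B by rewrite mulr_gt0// divr_gt0// kE mulr_gt0.
have Z0 : 0 < Z := mulr_gt0 (divr_gt0 Y0 ka0) n0'.
have h : `|BO_expect a n (fun G => (Y n k G)%:R) - Z| <= Z * (A + B).
  have := hC n k n0 k1; rewrite lgE -/Z (_ : n%:R * (_ / _) = Z); last by rewrite /Z mulrC.
  move=> /le_trans; apply; rewrite le_eqVlt; apply/orP; left; apply/eqP.
  rewrite /Z /A /B kE; move: (tail_const a) (ln k%:R ^ z) (ln 2 ^ z) (k%:R `^ a) Y0 lz0 ka0.
  by move=> y u v w y0 v0 w0; field; rewrite !gt_eqF.
have [e1 [e2 [h1 h2 ->]]] := split_relative_error Z0 A0 B0 h.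
exists e1, e2; split.
- apply: (le_trans h1); rewrite /A [leRHS]mulrDl lerDl.
  by rewrite mulr_ge0 ?(ltW CY0)// divr_ge0 ?(ltW k0)// exprz_ge0// ltW.
- apply: (le_trans h2); rewrite /B [leRHS]mulrDl lerDr.
  exact: mulr_ge0 (divr_ge0 (ltW CY0) (ltW lz0)) (divr_ge0 (powR_ge0 _ _) (ltW n0')).
by congr (_ * _); rewrite /Z /tail_const; field; rewrite G1 gt_eqF.
Qed.
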